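(* Let $\alpha\in\mathbb{R}\setminus\mathbb{Q}$, let $v(x)=\sum_{k=-d}^d\hat v_ke^{2\pi ikx}$ be a real-valued trigonometric polynomial of degree $d\ge1$ ($\hat v_d\neq0$), and let $E\in\mathbb{R}$. If the dual cocycle $(\alpha,L_{E,v})$ is $PH2$, then there is no $B\in C^\omega(\mathbb{R}/\mathbb{Z},SL(2,\mathbb{R}))$ with $B(x+\alpha)^{-1}S_E^v(x)B(x)=\mathrm{Id}$ for all $x$.
   Context: $S_E^v(x)=\begin{pmatrix}E-v(x)&-1\\1&0\end{pmatrix}$ is the Schrödinger cocycle of $(Hu)_n=u_{n+1}+u_{n-1}+v(x+n\alpha)u_n$. The dual operator is $(L_{v,\alpha,\theta}u)_n=\sum_{k=-d}^d\hat v_ku_{n+k}+2\cos2\pi(\theta+n\alpha)u_n$, and its cocycle is $(\alpha,L_{E,v})$, $(\theta,w)\mapsto(\theta+\alpha,L_{E,v}(\theta)w)$, where $L_{E,v}(\theta)$ is the $2d\times2d$ matrix with first row $\frac1{\hat v_d}(-\hat v_{d-1},\dots,-\hat v_1,E-2\cos2\pi\theta-\hat v_0,-\hat v_{-1},\dots,-\hat v_{-d})$ and $(j+1)$-th row $e_j^T$ for $j=1,\dots,2d-1$. Iterates: $(L_{E,v})_n(\theta)=L_{E,v}(\theta+(n-1)\alpha)\cdots L_{E,v}(\theta)$. A cocycle $(\alpha,A)$ on $\mathbb{C}^m$ is $k$-dominated if there is a continuous splitting $\mathbb{C}^m=E^+(\theta)\oplus E^-(\theta)$ with $\dim E^+=k$,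 $A(\theta)E^\pm(\theta)=E^\pm(\theta+\alpha)$, and $N\ge1$ with $\|A_N(\theta)u\|>\|A_N(\theta)w\|$ for all $\theta$ and unit $u\in E^+(\theta)$, $w\in E^-(\theta)$. A $2d$-dimensional cocycle is $PH2$ (partially hyperbolic with two-dimensional center) if it is both $(d-1)$-dominated and $(d+1)$-dominated. *)

(* Defs.v *)
From HB Require Import structures.
From mathcomp Require Import all_boot all_order all_algebra.
From mathcomp Require Import all_classical all_reals all_analysis.
From mathcomp Require Import complex.
Set Implicit Arguments. Unset Strict Implicit. Unset Printing Implicit Defensive.
Import Order.TTheory GRing.Theory Num.Theory.
Import numFieldNormedType.Exports.
Local Open Scope classical_set_scope.
Local Open Scope ring_scope.

Section Defs.
Variable R : realType.
Local Notation C := R[i].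

Definition hnorm (m : nat) (u : 'cV[C]_m) : R :=
  Num.sqrt (\sum_(i < m) (complex.Re (u i 0) ^+ 2 + complex.Im (u i 0) ^+ 2)).

Definition trig_polyC (d : nat) (vhat : int -> C) (x : R) : C :=
  \sum_(j < (d.*2).+1)
     vhat (j%:Z - d%:Z) *
     (cos (2 * pi * (j%:Z - d%:Z)%:~R * x) +i* sin (2 * pi * (j%:Z - d%:Z)%:~R * x))%C.

(* its (real) value, when the polynomial is real-valued *)
Definition trig_poly (d : nat) (vhat : int -> C) (x : R) : R := complex.Re (trig_polyC d vhat x).

Definition schr (d : nat) (vhat : int -> C) (E : R) (x : R) : 'M[R]_2 :=
  \matrix_(i < 2, j < 2)
    if (i == 0 :> nat) then (if (j == 0 :> nat) then E - trig_poly d vhat x else -1)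
    else (if (j == 0 :> nat) then 1 else 0).

(* the dual cocycle matrix L_{E,v}(theta) in M_{2d}(C):
   first row (1/vhat_d)(-vhat_{d-1},...,-vhat_1, E - 2cos 2 pi theta - vhat_0,
                        -vhat_{-1},...,-vhat_{-d}),
   row (j+1) = e_j^T for j = 1..2d-1 (i.e. 0-indexed row i>=1 has a 1 in column i-1). *)
Definition dual_mat (d : nat) (vhat : int -> C) (E : R) (theta : R) : 'M[C]_(d.*2) :=
  \matrix_(i < d.*2, j < d.*2)
    if (i == 0 :> nat) then
      (if (j == d.-1 :> nat)
       then ((E - 2 * cos (2 * pi * theta))%:C%C - vhat 0) / vhat (d%:Z)
       else - vhat (d%:Z - 1 - j%:Z) / vhat (d%:Z))
    else (if (j.+1 == i :> nat) then 1 else 0).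

Fixpoint cocycle_iter (m : nat) (alpha : R) (A : R -> 'M[C]_m) (n : nat) (theta : R)
  : 'M[C]_m :=
  match n with
  | 0 => 1%:M
  | n'.+1 => A (theta + n'%:R * alpha) *m cocycle_iter alpha A n' theta
  end.

Definition cont_subbundle (m k : nat) (Es : R -> 'cV[C]_m -> Prop) : Prop :=
  forall theta0 : R, exists2 delta : R, 0 < delta &
    exists F : R -> 'M[C]_(m, k),
      (forall theta, `|theta - theta0| < delta ->
         (forall (i : 'I_m) (j : 'I_k),
            {for theta, continuous (fun t => complex.Re (F t i j))} /\
            {for theta, continuous (fun t => complex.Im (F t i j))}) /\
         \rank (F theta) = k /\
         (forall u, Es theta u <-> exists c : 'cV[C]_k, u = F theta *m c)).

Definition dominated (m : nat) (k : nat) (alpha : R) (A : R -> 'M[C]_m) : Prop :=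
  (k <= m)%N /\
  exists (Ep Em : R -> 'cV[C]_m -> Prop) (N : nat),
    (forall theta, Ep (theta + 1) = Ep theta /\ Em (theta + 1) = Em theta) /\
    cont_subbundle k Ep /\ cont_subbundle (m - k) Em /\
    (forall theta (w : 'cV[C]_m), exists u v, Ep theta u /\ Em theta v /\ w = u + v) /\
    (forall theta (u : 'cV[C]_m), Ep theta u -> Em theta u -> u = 0) /\
    (forall theta u, Ep (theta + alpha) u <-> exists2 u', Ep theta u' & u = A theta *m u') /\
    (forall theta u, Em (theta + alpha) u <-> exists2 u', Em theta u' & u = A theta *m u') /\
    (1 <= N)%N /\
    (forall theta u w, Ep theta u -> Em theta w -> hnorm u = 1 -> hnorm w = 1 ->
       hnorm (cocycle_iter alpha A N theta *m w) < hnorm (cocycle_iter alpha A N theta *m u)).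

(* partially hyperbolic with two-dimensional center, for a 2d-dimensional cocycle *)
Definition PH2 (d : nat) (alpha : R) (A : R -> 'M[C]_(d.*2)) : Prop :=
  dominated d.-1 alpha A /\ dominated d.+1 alpha A.

Definition real_analytic (f : R -> R) : Prop :=
  forall x0 : R, exists2 r : R, 0 < r &
    exists a : nat -> R, forall x, `|x - x0| < r ->
      series (fun n => a n * (x - x0) ^+ n) @ \oo --> f x.

Definition analytic_SL2_loop (B : R -> 'M[R]_2) : Prop :=
  (forall x, B (x + 1) = B x) /\
  (forall x, \det (B x) = 1) /\
  (forall i j : 'I_2, real_analytic (fun x => B x i j)).

End Defs.

Arguments PH2 {R} d alpha A.
Arguments dominated {R} m k alpha A.

(* Main.v *)
Require Import Defs.
From HB Require Import structures.
From mathcomp Require Import all_boot all_order all_algebra.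
From mathcomp Require Import all_classical all_reals all_analysis.
From mathcomp Require Import complex.
From mathcomp Require Import ring lra zify.
Set Implicit Arguments. Unset Strict Implicit. Unset Printing Implicit Defensive.
Import Order.TTheory GRing.Theory Num.Theory.
Import numFieldNormedType.Exports.
Import ComplexField.Normc.
Local Open Scope classical_set_scope.
Local Open Scope ring_scope.

(* If B conjugates S_E^v to the identity, the entries a, b of its first row are continuous periodic solutions of f(x + alpha) + f(x - alpha) + v(x) f(x) = E f(x), so their Fourier coefficients are two linearly independent orbits of the dual cocycle over theta = 0 that tend to 0 at both ends.

Let C^{2d} = E^+ + E^- be the (d+1)-dominated splitting. The dual cocycle preserves a nondegenerate skew-Hermitian (Wronskian) form, for which two orbits that both tend to 0 in the same time direction are orthogonal; an isotropic space has dimension at most d. If one of the two decaying orbits had a nonzero E^- component, that component would decay backwards (angles are bounded below by compactness) and would dominate E^+ backwards, making E^+ isotropic of dimension d + 1. So both orbits lie in E^+; being decaying forwards they force E^- to decay forwards, and E^- plus their span is isotropic of dimension (d - 1) + 2, a contradiction.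

Fourier coefficients are taken with respect to the mean of samples along the orbit (j alpha)_j instead of an integral: linearity, positivity, invariance under translation by alpha and orthogonality of characters (this uses that alpha is irrational) suffice for Bessel's inequality and for uniqueness by the Fejer kernel. *)

(** * The conserved Wronskian form of the dual operator *)

Section Form.
Variable R : realType.
Local Notation C := R[i].
Variables (d : nat) (v : int -> C).

(* The weight is that of the Wronskian (Green's formula) of the difference operator: it is supported on pairs of sites on opposite sides of the cut d - 1 | d. *)
Definition wronskian_coef (p q : nat) : C :=
  ((p < d)%N%:R - (q < d)%N%:R) *
  (if (`|q%:Z - p%:Z| <= d)%N then v (q%:Z - p%:Z) else 0).

Definition wronskian_mx : 'M[C]_(d.*2) := \matrix_(p, q) wronskian_coef p q.

Definition wronskian (x y : 'cV[C]_(d.*2)) : C :=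
  \sum_p \sum_q wronskian_mx p q * (x p 0 * (y q 0)^*%C).

(** Moving the cut by one site changes the weight only on row and column [d]. There the two
    recurrences give the same product, [e] times [z d] times the conjugate of [w d], with opposite
    signs, because [e] is real and the coefficients are Hermitian. *)
Lemma wronskian_shift (z w : nat -> C) (e : C) :
  (forall k, (`|k| <= d)%N -> v (- k) = (v k)^*%C) ->
  e^*%C = e ->
  \sum_(p < d.*2.+1) v (d%:Z - p%:Z) * z p = e * z d ->
  \sum_(p < d.*2.+1) v (d%:Z - p%:Z) * w p = e * w d ->
  \sum_(p < d.*2) \sum_(q < d.*2) wronskian_coef p q * (z p * (w q)^*%C) =
  \sum_(p < d.*2) \sum_(q < d.*2) wronskian_coef p q * (z p.+1 * (w q.+1)^*%C).
Proof.
move=> vN er zE wE.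
pose vt (k : int) := if (`|k| <= d)%N then v k else 0.
pose S (c : nat -> nat -> C) :=
  \sum_(p < d.*2.+1) \sum_(q < d.*2.+1) c p q * (z p * (w q)^*%C).
pose c1 p q := ((p <= d)%N%:R - (q <= d)%N%:R) * vt (q%:Z - p%:Z).
(* The added site [2d] contributes nothing: all sites within distance [d] of it lie on its side of
   the cut. *)
have -> : \sum_(p < d.*2) \sum_(q < d.*2) wronskian_coef p q * (z p * (w q)^*%C) =
    S wronskian_coef.
  rewrite /S big_ord_recr /= [X in _ = _ + X]big1 ?addr0; last first.
    move=> q _; rewrite /wronskian_coef.
    case: ifP => h; last by rewrite mulr0 mul0r.
    have -> : (d.*2 < d)%N = false by lia.
    have -> : (q < d)%N = false by lia.
    by rewrite subrr !mul0r.
  apply: eq_bigr => p _; rewrite big_ord_recr /= /wronskian_coef.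
  case: ifP => [h|_]; last by rewrite !mulr0 !mul0r addr0.
  have -> : (d.*2 < d)%N = false by lia.
  have -> : (p < d)%N = false by lia.
  by rewrite subrr !mul0r addr0.
(* After reindexing, the cut lies just after site [d], and the added site 0 contributes nothing for
   the same reason. *)
have -> : \sum_(p < d.*2) \sum_(q < d.*2) wronskian_coef p q * (z p.+1 * (w q.+1)^*%C) =
    S c1.
  rewrite /S big_ord_recl /= [X in _ = X + _]big1 ?add0r; last first.
    move=> q _; rewrite /c1 /vt.
    case: ifP => h; last by rewrite mulr0 mul0r.
    have -> : (q <= d)%N by lia.
    by rewrite subrr !mul0r.
  apply: eq_bigr => p _; rewrite big_ord_recl /= {1}/c1 {1}/vt /bump /= !add1n.
  rewrite [X in _ = X + _](_ : _ = 0) ?add0r; last first.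
    case: ifP => [h|_]; last by rewrite !mulr0 !mul0r.
    have -> : (p.+1 <= d)%N by lia.
    by rewrite subrr !mul0r.
  apply: eq_bigr => q _; rewrite /c1 /wronskian_coef /vt /bump /= !add1n.
  by have -> : q.+1%:Z - p.+1%:Z = q%:Z - p%:Z by lia.
have vtN k : vt (- k) = (vt k)^*%C.
  by rewrite /vt abszN; case: ifP => [/vN //|_]; rewrite conjc0.
have vtE (p : 'I_(d.*2.+1)) : vt (d%:Z - p%:Z) = v (d%:Z - p%:Z).
  by rewrite /vt ifT //; have := ltn_ord p; lia.
have hd : (d < d.*2.+1)%N by lia.
have cE (p q : nat) : wronskian_coef p q * (z p * (w q)^*%C) =
    c1 p q * (z p * (w q)^*%C) +
    ((q == d)%:R * (vt (q%:Z - p%:Z) * (z p * (w q)^*%C)) -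
     (p == d)%:R * (vt (q%:Z - p%:Z) * (z p * (w q)^*%C))).
  rewrite /wronskian_coef -/(vt _) /c1.
  case: (ltngtP p d) => hp; case: (ltngtP q d) => hq;
    rewrite ?(mulr1n,mulr0n,subrr,mul0r,mul1r,subr0,sub0r,mulN1r,mulNr,add0r,addr0,addNr) //.
have pickd (F : nat -> C) : \sum_(q < d.*2.+1) (q == d :> nat)%:R * F q = F d.
  rewrite (bigD1 (Ordinal hd)) //= eqxx mul1r big1 ?addr0 // => q /eqP hq.
  rewrite (_ : (q == d :> nat) = false) ?mul0r //.
  by apply/eqP => h; apply: hq; apply: val_inj.
pose T (p q : nat) := vt (q%:Z - p%:Z) * (z p * (w q)^*%C).
have -> : S wronskian_coef = S c1 +
    (\sum_(p < d.*2.+1) T p d - \sum_(q < d.*2.+1) T d q).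
  rewrite -(pickd (fun p => \sum_(q < d.*2.+1) T p q)) -sumrB -big_split /=.
  apply: eq_bigr => p _; rewrite mulr_sumr -(pickd (T p)) -sumrB -big_split /=.
  by apply: eq_bigr => q _; rewrite cE.
rewrite [X in X - _](_ : _ = e * (z d * (w d)^*%C)); last first.
  rewrite mulrA -zE mulr_suml; apply: eq_bigr => p _.
  by rewrite /T vtE mulrA.
rewrite [X in _ - X](_ : _ = e * (z d * (w d)^*%C)) ?subrr ?addr0 //.
rewrite mulrCA -{1}er -rmorphM /= -wE rmorph_sum mulr_sumr; apply: eq_bigr => q _.
by rewrite /T -opprB vtN vtE rmorphM /= mulrCA.
Qed.

(** Pairs on the same side of the cut or further apart than [d] have weight 0, and pairs at distance
    exactly [d] across it carry [v d] or [v (- d)] up to sign. The off-diagonal blocks are thus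
    triangular, and substitution kills a left null vector. *)
Lemma wronskian_mx_unit : (1 <= d)%N -> v d%:Z != 0 -> v (- d%:Z) != 0 ->
  wronskian_mx \in unitmx.
Proof.
move=> d1 vd vNd; rewrite -row_free_unit; apply: inj_row_free => x /rowP xO.
have sumO (q : 'I_(d.*2)) : \sum_p x 0 p * wronskian_coef p q = 0.
  have := xO q; rewrite [LHS]mxE [RHS]mxE => xq; rewrite -[RHS]xq.
  by apply: eq_bigr => p _; rewrite mxE.
have pick (p q : 'I_(d.*2)) : (forall p' : 'I_(d.*2), p' != p ->
    x 0 p' = 0 \/ wronskian_coef p' q = 0) -> wronskian_coef p q != 0 -> x 0 p = 0.
  move=> pz cn; have := sumO q; rewrite (bigD1 p) //= big1 ?addr0.
    by move/eqP; rewrite mulf_eq0 (negPf cn) orbF => /eqP.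
  by move=> p' /pz [] ->; rewrite ?mul0r ?mulr0.
(* Column [p + d] has its pivot in row [p]; the rows below [d] are cleared from [d - 1]
   downwards. *)
have low n : forall p : 'I_(d.*2), (d = p + n.+1)%N -> x 0 p = 0.
  elim/ltn_ind: n => n IH p pE.
  have hq : (p + d < d.*2)%N by lia.
  apply: (pick p (Ordinal hq)) => [p' /eqP p'p|]; rewrite /wronskian_coef /=.
    case: (ltnP p' p) => h; first by right; rewrite ifF ?mulr0 //; lia.
    case: (ltnP p' d) => h2.
      left; have p'p2 : (p : nat) <> p' by move=> /val_inj/esym.
      by apply: (IH (d - p').-1); lia.
    by right; rewrite (_ : (p + d < d)%N = false) ?subrr ?mul0r //; lia.
  rewrite (_ : (p + d)%:Z - p%:Z = d%:Z); last lia.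
  have -> : (p < d)%N by lia.
  have -> : (p + d < d)%N = false by lia.
  by rewrite absz_nat leqnn subr0 mul1r.
(* Column [n] has its pivot in row [d + n]; the remaining rows are cleared from [d] upwards. *)
have high n : forall p : 'I_(d.*2), (p = d + n :> nat)%N -> x 0 p = 0.
  elim/ltn_ind: n => n IH p pE.
  have hq : (n < d.*2)%N by have := ltn_ord p; lia.
  have nd : (n < d)%N by have := ltn_ord p; lia.
  apply: (pick p (Ordinal hq)) => [p' /eqP p'p|]; rewrite /wronskian_coef /=.
    case: (ltnP p p') => h; first by right; rewrite ifF ?mulr0 //; lia.
    case: (ltnP p' d) => h2; first by right; rewrite nd subrr mul0r.
    left; have p'p2 : (p : nat) <> p' by move=> /val_inj/esym.
    by apply: (IH (p' - d)%N); lia.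
  rewrite (_ : n%:Z - p%:Z = - d%:Z); last lia.
  have -> : (p < d)%N = false by lia.
  by rewrite nd abszN absz_nat leqnn sub0r mulN1r oppr_eq0.
apply/rowP => p; rewrite [in RHS]mxE; case: (ltnP p d) => h.
  by apply: (low (d - p).-1); lia.
by apply: (high (p - d)%N); lia.
Qed.

(** Isotropy makes the product of [W^T] with [wronskian_mx] times the conjugate of [W] vanish. Both
    factors have rank [k], so [k + k <= 2d]. *)
Lemma isotropic_rank (k : nat) (W : 'M[C]_(d.*2, k)) :
  wronskian_mx \in unitmx ->
  (forall i j, wronskian (col i W) (col j W) = 0) ->
  \rank W = k -> (k <= d)%N.
Proof.
move=> Ou iso Wk.
have : W^T *m (wronskian_mx *m map_mx (@conjc R) W) = 0.
  apply/matrixP => i j; rewrite mxE [RHS]mxE -[RHS](iso i j) /wronskian.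
  apply: eq_bigr => p _; rewrite [X in _ * X]mxE mulr_sumr; apply: eq_bigr => q _.
  by rewrite !mxE; ring.
move/mulmx0_rank_max; rewrite mxrank_tr Wk.
have -> : \rank (wronskian_mx *m map_mx (@conjc R) W) = k.
  by rewrite -mxrank_tr trmx_mul mxrankMfree ?mxrank_tr ?mxrank_map // row_free_unit unitmx_tr.
by lia.
Qed.

Hypothesis vN : forall k, (`|k| <= d)%N -> v (- k) = (v k)^*%C.
Hypotheses (d1 : (1 <= d)%N) (vd : v d%:Z != 0).

Lemma dual_mat_mulS E theta (x : 'cV[C]_(d.*2)) (i j : 'I_(d.*2)) :
  i = j.+1 :> nat -> (dual_mat d v E theta *m x) i 0 = x j 0.
Proof.
move=> ij; rewrite mxE (bigD1 j) //= mxE ij /= eqxx mul1r big1 ?addr0 // => k /eqP kj.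
rewrite mxE ij /= ifF ?mul0r //; apply/negP => /eqP [h]; apply: kj; exact: val_inj.
Qed.

(** The first row of [dual_mat] is the eigenvalue equation at the middle of a window of [2d + 1]
    sites, solved for the new site. The window [z] puts that new value in front of [x]. *)
Lemma dual_mat_recE E theta (x : 'cV[C]_(d.*2)) (z : nat -> C) :
  (forall j : 'I_(d.*2), z j.+1 = x j 0) ->
  (forall j : 'I_(d.*2), z j = (dual_mat d v E theta *m x) j 0) ->
  \sum_(p < d.*2.+1) v (d%:Z - p%:Z) * z p = (E - 2 * cos (2 * pi * theta))%:C%C * z d.
Proof.
move=> zx zAx.
have h0 : (0 < d.*2)%N by lia.
have hd1 : (d.-1 < d.*2)%N by lia.
have zd : z d = x (Ordinal hd1) 0 by rewrite -zx /= prednK.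
rewrite big_ord_recl /= subr0.
have -> : v d * z 0%N = (E - 2 * cos (2 * pi * theta))%:C%C * z d -
    \sum_(j < d.*2) v (d%:Z - 1 - j%:Z) * x j 0.
  have -> : z 0%N = \sum_j dual_mat d v E theta (Ordinal h0) j * x j 0.
    by rewrite (zAx (Ordinal h0)) mxE.
  rewrite mulr_sumr.
  rewrite (bigD1 (Ordinal hd1)) //= [in RHS](bigD1 (Ordinal hd1)) //= mxE /= eqxx -zd.
  rewrite opprD addrA; congr (_ + _).
    rewrite (_ : d%:Z - 1 - d.-1%:Z = 0); last lia.
    by field.
  rewrite -sumrN; apply: eq_bigr => j jn; rewrite mxE /= ifF; first by field.
  by apply/negP => /eqP h; move/eqP: jn; apply; apply: val_inj.
rewrite -addrA -[RHS]addr0; congr (_ + _); apply/eqP; rewrite addrC subr_eq0; apply/eqP.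
apply: eq_bigr => j _; rewrite /bump /= add1n zx; congr (v _ * _); lia.
Qed.

(** One step of the cocycle slides the window of sites by one, so conservation under a shift becomes
    invariance of the form. *)
Lemma wronskian_dual_mat E theta x y :
  wronskian (dual_mat d v E theta *m x) (dual_mat d v E theta *m y) = wronskian x y.
Proof.
have h0 : (0 < d.*2)%N by lia.
(* The window of [x] preceded by the new site; the default 0 is met only past its end. *)
pose ext (x : 'cV[C]_(d.*2)) (n : nat) : C :=
  if n is j.+1 then (if insub j is Some j' then x j' 0 else 0)
  else (dual_mat d v E theta *m x) (Ordinal h0) 0.
have extS x' (j : 'I_(d.*2)) : ext x' j.+1 = x' j 0 by rewrite /ext valK.
have extA x' (j : 'I_(d.*2)) : ext x' j = (dual_mat d v E theta *m x') j 0.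
  case: j => -[|j] hj; first by rewrite /=; congr (_ _ _); apply: val_inj.
  have hj' : (j < d.*2)%N by lia.
  rewrite (_ : nat_of_ord (Ordinal hj) = (Ordinal hj').+1) // extS.
  by rewrite (@dual_mat_mulS E theta x' _ (Ordinal hj')).
have := @wronskian_shift (ext x) (ext y) (E - 2 * cos (2 * pi * theta))%:C%C vN
  (conjc_real _) (dual_mat_recE (extS x) (extA x)) (dual_mat_recE (extS y) (extA y)).
rewrite /wronskian => wE.
transitivity (\sum_(p < d.*2) \sum_(q < d.*2) wronskian_coef p q * (ext x p * (ext y q)^*%C)).
  by apply: eq_bigr => p _; apply: eq_bigr => q _; rewrite mxE !extA.
by rewrite wE; apply: eq_bigr => p _; apply: eq_bigr => q _; rewrite mxE !extS.
Qed.

End Form.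

(** * Norms and subbundles *)

Section ComplexNorm.
Variable R : realType.
Local Notation C := R[i].
Implicit Types x y z : C.

Lemma normc_ge0 x : 0 <= normc x.
Proof. by case: x => a b; exact: sqrtr_ge0. Qed.

Lemma normc_conj x : normc x^*%C = normc x.
Proof. by case: x => a b /=; rewrite sqrrN. Qed.

Lemma normcE x : normc x = Num.sqrt (complex.Re x ^+ 2 + complex.Im x ^+ 2).
Proof. by case: x. Qed.

Lemma sqr_normc x : normc x ^+ 2 = complex.Re x ^+ 2 + complex.Im x ^+ 2.
Proof. by rewrite normcE sqr_sqrtr // addr_ge0 // sqr_ge0. Qed.

Lemma mulc_conj x : x * x^*%C = (normc x ^+ 2)%:C%C.
Proof. by rewrite sqr_normc; case: x => a b /=; simpc; congr (_ +i* _)%C; ring. Qed.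

Lemma normc_real (r : R) : normc r%:C%C = `|r|.
Proof. by rewrite /= expr0n /= addr0 sqrtr_sqr. Qed.

Lemma Re_le_normc x : `|complex.Re x| <= normc x.
Proof. by rewrite normcE -sqrtr_sqr ler_wsqrtr // lerDl sqr_ge0. Qed.

Lemma Im_le_normc x : `|complex.Im x| <= normc x.
Proof. by rewrite normcE -sqrtr_sqr ler_wsqrtr // lerDr sqr_ge0. Qed.

Lemma normc_le_ReIm x : normc x <= `|complex.Re x| + `|complex.Im x|.
Proof.
rewrite -(ler_pXn2r (ltn0Sn 1)) ?nnegrE ?normc_ge0 ?addr_ge0 //.
rewrite sqr_normc -(real_normK (num_real (complex.Re x))).
rewrite -(real_normK (num_real (complex.Im x))) sqrrD.
by rewrite lerD2r lerDl mulrn_wge0 // mulr_ge0.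
Qed.

Lemma complex_ReD x y : complex.Re (x + y) = complex.Re x + complex.Re y.
Proof. by case: x y => [? ?] [? ?]. Qed.

Lemma complex_ImD x y : complex.Im (x + y) = complex.Im x + complex.Im y.
Proof. by case: x y => [? ?] [? ?]. Qed.

Lemma complex_ReM x y : complex.Re (x * y) =
  complex.Re x * complex.Re y - complex.Im x * complex.Im y.
Proof. by case: x y => [? ?] [? ?]. Qed.

Lemma complex_ImM x y : complex.Im (x * y) =
  complex.Re x * complex.Im y + complex.Im x * complex.Re y.
Proof. by case: x y => [? ?] [? ?]. Qed.

Lemma complex_ReN x : complex.Re (- x) = - complex.Re x.
Proof. by case: x. Qed.

Lemma complex_ImN x : complex.Im (- x) = - complex.Im x.
Proof. by case: x. Qed.

Lemma Re_conjc x : complex.Re x^*%C = complex.Re x.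
Proof. by case: x. Qed.

Lemma Im_conjc x : complex.Im x^*%C = - complex.Im x.
Proof. by case: x. Qed.

Lemma le_normc_sum (I : Type) (s : seq I) (P : pred I) (F : I -> C) :
  normc (\sum_(i <- s | P i) F i) <= \sum_(i <- s | P i) normc (F i).
Proof.
elim/big_ind2: _ => [|x a y b xa yb|//]; first by rewrite normc0.
by rewrite (le_trans (le_normcD _ _)) // lerD.
Qed.

(** The entrywise l1 norm: submultiplicative, and comparable with [hnorm] on columns, which suffices
    for the perturbation estimate on frames. *)
Definition mxnorm1 (m n : nat) (M : 'M[C]_(m, n)) : R := \sum_i \sum_j normc (M i j).

Lemma mxnorm1_ge0 m n (M : 'M[C]_(m, n)) : 0 <= mxnorm1 M.
Proof. by do 2 apply: sumr_ge0 => ? _; exact: normc_ge0. Qed.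

Lemma mxnorm1D m n (M N : 'M[C]_(m, n)) : mxnorm1 (M + N) <= mxnorm1 M + mxnorm1 N.
Proof.
rewrite /mxnorm1 -big_split /=; apply: ler_sum => i _.
rewrite -big_split /=; apply: ler_sum => j _; rewrite mxE; exact: le_normcD.
Qed.

Lemma mxnorm1N m n (M : 'M[C]_(m, n)) : mxnorm1 (- M) = mxnorm1 M.
Proof. by apply: eq_bigr => i _; apply: eq_bigr => j _; rewrite mxE normcN. Qed.

Lemma mxnorm1_mul m n p (M : 'M[C]_(m, n)) (N : 'M[C]_(n, p)) :
  mxnorm1 (M *m N) <= mxnorm1 M * mxnorm1 N.
Proof.
rewrite /mxnorm1 mulr_suml; apply: ler_sum => i _.
rewrite mulr_suml.
apply: (@le_trans _ _ (\sum_j \sum_k normc (M i k) * normc (N k j))).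
  apply: ler_sum => j _; rewrite mxE (le_trans (le_normc_sum _ _ _)) //.
  by apply: ler_sum => k _; rewrite normcM.
rewrite exchange_big /=; apply: ler_sum => k _; rewrite -mulr_sumr.
rewrite ler_wpM2l ?normc_ge0 // [leRHS](bigD1 k) //= lerDl.
by do 2 apply: sumr_ge0 => ? _; exact: normc_ge0.
Qed.

Variable m : nat.
Implicit Types u v : 'cV[C]_m.

Lemma hnormE u : hnorm u = Num.sqrt (\sum_i normc (u i 0) ^+ 2).
Proof. by congr Num.sqrt; apply: eq_bigr => i _; rewrite sqr_normc. Qed.

Lemma hnorm_ge0 u : 0 <= hnorm u. Proof. exact: sqrtr_ge0. Qed.

Lemma hnorm0 : hnorm (0 : 'cV[C]_m) = 0.
Proof. by rewrite hnormE big1 ?sqrtr0 // => i _; rewrite mxE normc0 expr0n. Qed.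

Lemma normc_le_hnorm u i : normc (u i 0) <= hnorm u.
Proof.
rewrite hnormE -[leLHS]ger0_norm ?normc_ge0 // -sqrtr_sqr ler_wsqrtr //.
by rewrite (bigD1 i) //= lerDl sumr_ge0 // => ? _; exact: sqr_ge0.
Qed.

Lemma hnorm_le_mxnorm1 u : hnorm u <= mxnorm1 u.
Proof.
rewrite hnormE -[leRHS]ger0_norm ?mxnorm1_ge0 // -sqrtr_sqr ler_wsqrtr //.
have -> : mxnorm1 u = \sum_i normc (u i 0).
  by apply: eq_bigr => i _; rewrite big_ord1.
rewrite expr2 mulr_suml; apply: ler_sum => i _; rewrite expr2 ler_wpM2l ?normc_ge0 //.
by rewrite (bigD1 i) //= lerDl sumr_ge0 // => ? _; exact: normc_ge0.
Qed.

Lemma mxnorm1_le_hnorm u : mxnorm1 u <= m%:R * hnorm u.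
Proof.
apply: (@le_trans _ _ (\sum_(i < m) hnorm u)).
  by apply: ler_sum => i _; rewrite big_ord1 normc_le_hnorm.
by rewrite sumr_const card_ord mulr_natl.
Qed.

Lemma hnorm_eq0 u : hnorm u = 0 -> u = 0.
Proof.
move=> u0; apply/colP => i; rewrite mxE; apply: eq0_normc; apply/eqP.
by rewrite eq_le normc_ge0 andbT -u0 normc_le_hnorm.
Qed.

Lemma hnorm_gt0 u : u != 0 -> 0 < hnorm u.
Proof.
by move=> u0; rewrite lt_def hnorm_ge0 andbT; apply: contra u0 => /eqP/hnorm_eq0 ->.
Qed.

Lemma hnormZ (c : C) u : hnorm (c *: u) = normc c * hnorm u.
Proof.
rewrite !hnormE -[normc c]ger0_norm ?normc_ge0 // -sqrtr_sqr -sqrtrM ?sqr_ge0 //.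
congr Num.sqrt; rewrite mulr_sumr; apply: eq_bigr => i _.
by rewrite mxE normcM exprMn.
Qed.
End ComplexNorm.

Section Subbundles.
Variable R : realType.
Local Notation C := R[i].

Lemma full_col_rank_inj m k n (F : 'M[C]_(m, k)) (c : 'M[C]_(k, n)) :
  \rank F = k -> F *m c = 0 -> c = 0.
Proof.
move=> Fk Fc; apply: trmx_inj; rewrite trmx0; apply: (@row_free_inj _ _ _ _ F^T).
  by rewrite /row_free mxrank_tr Fk.
by rewrite mul0mx -trmx_mul Fc trmx0.
Qed.

(** Fibres are bare predicates; their linear structure has to be read off from a frame. *)
Lemma cont_subbundleP m k (Es : R -> 'cV[C]_m -> Prop) theta :
  cont_subbundle k Es -> exists F : 'M[C]_(m, k),
    \rank F = k /\ (forall u, Es theta u <-> exists c, u = F *m c).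
Proof.
move=> /(_ theta) [e e0 [F /(_ theta)]]; rewrite subrr normr0 => /(_ e0) [_ FE].
by exists (F theta).
Qed.

Lemma cont_subbundleD m k (Es : R -> 'cV[C]_m -> Prop) theta u v :
  cont_subbundle k Es -> Es theta u -> Es theta v -> Es theta (u + v).
Proof.
move=> /(cont_subbundleP theta) [F [_ FE]] /FE [c ->] /FE [e ->].
by apply/FE; exists (c + e); rewrite mulmxDr.
Qed.

Lemma cont_subbundleZ m k (Es : R -> 'cV[C]_m -> Prop) theta a u :
  cont_subbundle k Es -> Es theta u -> Es theta (a *: u).
Proof.
move=> /(cont_subbundleP theta) [F [_ FE]] /FE [c ->].
by apply/FE; exists (a *: c); rewrite scalemxAr.
Qed.

Lemma periodic_int T (f : R -> T) : (forall x, f (x + 1) = f x) ->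
  forall (n : int) x, f (x + n%:~R) = f x.
Proof.
move=> f1; have fn (n : nat) x : f (x + n%:R) = f x.
  by elim: n x => [|n IH] x; rewrite ?addr0 // -natr1 addrA f1.
by case=> n x; [exact: fn|rewrite -(fn n.+1) NegzE mulrNz subrK].
Qed.

Definition ccont (f : R -> C) (x : R) :=
  {for x, continuous (fun t => complex.Re (f t))} /\
  {for x, continuous (fun t => complex.Im (f t))}.

Lemma ccont_cst a x : ccont (fun=> a) x.
Proof. by split; exact: cvg_cst. Qed.

Lemma ccontD f g x : ccont f x -> ccont g x -> ccont (fun t => f t + g t) x.
Proof.
move=> [f1 f2] [g1 g2]; split.
  under [X in {for _, continuous X}]eq_fun do rewrite complex_ReD; exact: cvgD.
under [X in {for _, continuous X}]eq_fun do rewrite complex_ImD; exact: cvgD.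
Qed.

Lemma ccontM f g x : ccont f x -> ccont g x -> ccont (fun t => f t * g t) x.
Proof.
move=> [f1 f2] [g1 g2]; split.
  under [X in {for _, continuous X}]eq_fun do rewrite complex_ReM.
  by apply: cvgB; apply: cvgM.
under [X in {for _, continuous X}]eq_fun do rewrite complex_ImM.
by apply: cvgD; apply: cvgM.
Qed.

Lemma ccont_sum n (f : 'I_n -> R -> C) x :
  (forall i, ccont (f i) x) -> ccont (fun t => \sum_i f i t) x.
Proof.
move=> fx; elim: n f fx => [|n IH] f fx.
  under [X in ccont X]eq_fun do rewrite big_ord0; exact: ccont_cst.
under [X in ccont X]eq_fun do rewrite big_ord_recl.
by apply: ccontD => //; apply: IH.
Qed.

Lemma ccont_normc f x : ccont f x -> {for x, continuous (fun t => normc (f t))}.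
Proof.
move=> [f1 f2]; under [X in {for _, continuous X}]eq_fun do rewrite normcE !expr2.
apply: (@continuous_comp _ _ _ (fun t => complex.Re (f t) * complex.Re (f t) +
  complex.Im (f t) * complex.Im (f t))); last exact: sqrt_continuous.
by apply: cvgD; apply: cvgM.
Qed.

Lemma continuous_sum n (f : 'I_n -> R -> R) x :
  (forall i, {for x, continuous (f i)}) -> {for x, continuous (fun t => \sum_i f i t)}.
Proof.
move=> fx; elim: n f fx => [|n IH] f fx.
  under [X in {for _, continuous X}]eq_fun do rewrite big_ord0; exact: cvg_cst.
under [X in {for _, continuous X}]eq_fun do rewrite big_ord_recl.
by apply: cvgD; [exact: fx|apply: IH].
Qed.

Lemma ccont_mxnorm1 m n (f : R -> 'M[C]_(m, n)) x :
  (forall i j, ccont (fun t => f t i j) x) -> {for x, continuous (fun t => mxnorm1 (f t))}.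
Proof.
move=> fx; apply: continuous_sum => i; apply: continuous_sum => j.
exact: ccont_normc.
Qed.
End Subbundles.

(** * Uniform transversality of the splitting *)

Section Domination.
Variable R : realType.
Local Notation C := R[i].

Section Splitting.
Variables (m k l : nat) (Ep Em : R -> 'cV[C]_m -> Prop).
Hypotheses (cp : cont_subbundle k Ep) (cm : cont_subbundle l Em).
Hypothesis trivI : forall theta u, Ep theta u -> Em theta u -> u = 0.

(* Near [x] a left inverse of the frame at [x] is an approximate left inverse of the frame. *)
Lemma splitting_bound_near (x : R) : exists K, \forall theta \near x,
  forall u v, Ep theta u -> Em theta v -> hnorm v <= K * hnorm (u + v).
Proof.
have [ep ep0 [F FE]] := cp x; have [em em0 [G GE]] := cm x.
have xp : `|x - x| < ep by rewrite subrr normr0.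
have xm : `|x - x| < em by rewrite subrr normr0.
pose M t := row_mx (F t) (G t).
(* [M x] is injective because both frames have full rank and the fibres meet only in 0. *)
have [P PM] : exists P, P *m M x = 1%:M.
  have : row_free (M x)^T.
    apply: inj_row_free => w Mw0.
    have Mw : M x *m w^T = 0 by apply: trmx_inj; rewrite trmx_mul trmxK Mw0 trmx0.
    have [_ [rF EF]] := FE x xp; have [_ [rG EG]] := GE x xm.
    move: Mw; rewrite -[w^T]vsubmxK mul_row_col => Mw.
    have Fw : F x *m usubmx w^T = 0.
      apply: (trivI (theta := x)); first by apply/EF; eexists.
      apply/EG; exists (- dsubmx w^T); rewrite mulmxN; apply/eqP.
      by rewrite -subr_eq0 opprK Mw.
    move: Mw; rewrite Fw add0r => /(full_col_rank_inj rG) w2.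
    have w1 := full_col_rank_inj rF Fw.
    by apply: trmx_inj; rewrite trmx0 -[w^T]vsubmxK w1 w2 col_mx0.
  case/row_freeP => B MB; exists B^T.
  by apply: trmx_inj; rewrite trmx_mul trmxK MB trmx1.
have cM i j : ccont (fun t => M t i j) x.
  case: (split_ordP j) => j' ->.
    under [X in ccont X]eq_fun do rewrite row_mxEl.
    by have [/(_ i j')] := FE x xp.
  under [X in ccont X]eq_fun do rewrite row_mxEr.
  by have [/(_ i j')] := GE x xm.
have cG i j : ccont (fun t => G t i j) x.
  by have [/(_ i j)] := GE x xm.
have cE : {for x, continuous (fun t => mxnorm1 (P *m M t - 1%:M))}.
  apply: ccont_mxnorm1 => i j; under [X in ccont X]eq_fun do rewrite mxE [X in X + _]mxE.
  by apply: ccontD; [apply: ccont_sum => ?; apply: ccontM => //|]; exact: ccont_cst.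
have cNG := ccont_mxnorm1 cG.
(* The first factor bounds the nearby frames of [Em], 2 comes from absorbing an error of norm [1/2],
   and [m] from comparing [mxnorm1] with [hnorm]. *)
exists ((mxnorm1 (G x) + 1) * (2 * mxnorm1 P * m%:R)).
near=> theta => u v.
have tp : `|theta - x| < ep by rewrite distrC; near: theta; exact: nbhsx_ballx.
have tm : `|theta - x| < em by rewrite distrC; near: theta; exact: nbhsx_ballx.
have [_ [_ EF]] := FE _ tp; have [_ [_ EG]] := GE _ tm.
case/EF => c ->; case/EG => e ->.
pose z := col_mx c e.
have wE : F theta *m c + G theta *m e = M theta *m z by rewrite mul_row_col.
have E12 : mxnorm1 (P *m M theta - 1%:M) <= 1/2.
  near: theta.
  move/cvgrPdist_le: cE => /(_ (1/2) ltac:(lra)); apply: filterS => t.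
  rewrite PM subrr.
  have -> : mxnorm1 (0 : 'M[C]_(k + l)) = 0.
    by apply: big1 => ? _; apply: big1 => ? _; rewrite mxE normc0.
  by rewrite sub0r normrN ger0_norm // mxnorm1_ge0.
have G1 : mxnorm1 (G theta) <= mxnorm1 (G x) + 1.
  near: theta.
  move/cvgrPdist_le: cNG => /(_ 1 ltr01); apply: filterS => t.
  by rewrite ler_distlC => /andP[_].
rewrite wE; set w := M theta *m z.
(* The second term is at most half of [z] in norm and is absorbed into the left-hand side. *)
have zE : z = P *m w - (P *m M theta - 1%:M) *m z.
  by rewrite mulmxBl mul1mx mulmxA opprB addrC subrK.
have z1 : mxnorm1 z <= mxnorm1 P * mxnorm1 w + 1/2 * mxnorm1 z.
  rewrite {1}zE (le_trans (mxnorm1D _ _)) // lerD ?mxnorm1_mul // mxnorm1N.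
  by rewrite (le_trans (mxnorm1_mul _ _)) // ler_wpM2r ?mxnorm1_ge0.
have z2 : mxnorm1 z <= 2 * (mxnorm1 P * mxnorm1 w) by lra.
have ez : mxnorm1 e <= mxnorm1 z.
  by rewrite /mxnorm1 big_split_ord /= addrC;
    under [X in _ <= X + _]eq_bigr do under eq_bigr do rewrite col_mxEd;
    rewrite lerDl; do 2 apply: sumr_ge0 => ? _; exact: normc_ge0.
apply: (le_trans (hnorm_le_mxnorm1 _)); apply: (le_trans (mxnorm1_mul _ _)).
rewrite -mulrA; apply: ler_pM; rewrite ?mxnorm1_ge0 //.
apply: (le_trans ez); apply: (le_trans z2); rewrite -!mulrA ler_wpM2l //.
by rewrite ler_wpM2l ?mxnorm1_ge0 // mxnorm1_le_hnorm.
Unshelve. all: by end_near. Qed.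

(** Compactness of a period makes the local bounds uniform. The result says that the projection onto
    [Em] along [Ep] is bounded, that is, the angle between the fibres stays away from 0. *)
Lemma splitting_bound :
  (forall theta, Ep (theta + 1) = Ep theta /\ Em (theta + 1) = Em theta) ->
  exists K, forall theta u v, Ep theta u -> Em theta v -> hnorm v <= K * hnorm (u + v).
Proof.
move=> per.
have /compact_near_coveringP cov := @segment_compact R 0 1.
pose P K theta := forall u v, Ep theta u -> Em theta v -> hnorm v <= K * hnorm (u + v).
(* The bound survives enlarging [K], so it is asked for all large [K], the form in which compactness
   merges the local constants. *)
have {cov} : \forall K \near +oo, `[0, 1]%classic `<=` P K.
  apply: cov => x _.
  have [K0 HK0] := splitting_bound_near x.
  exists ([set t | forall u v, Ep t u -> Em t v -> hnorm v <= K0 * hnorm (u + v)],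
          [set K | K0 <= K]).
    by split; [exact: HK0|apply: nbhs_pinfty_ge; rewrite num_real].
  move=> [t K] [/= H KK] u v Eu Ev.
  by apply: (le_trans (H _ _ Eu Ev)); rewrite ler_wpM2r ?hnorm_ge0.
case=> K [_ HK]; exists (K + 1) => theta u v.
have /andP[f0 f1] := floor_itv theta.
have -> : theta = (theta - (Num.floor theta)%:~R) + (Num.floor theta)%:~R by rewrite subrK.
rewrite (@periodic_int _ _ Ep) ?(@periodic_int _ _ Em) => [|t|t]; last 2 first.
- by have [] := per t.
- by have [] := per t.
apply: (HK (K + 1)); first by rewrite ltrDl.
rewrite /= in_itv /= subr_ge0 f0 /=; move: f1; rewrite intrD; lra.
Qed.
End Splitting.
End Domination.

(** * Decaying orbits of a dominated dual cocycle *)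

(** The quotient [b / a] is nonincreasing, in cross-multiplied form. This passes from domination
    over one block of [N] steps to any number of blocks. *)
Lemma ratio_le (R : realType) (a b : nat -> R) :
  (forall n, 0 < a n) -> (forall n, b n.+1 * a n <= a n.+1 * b n) ->
  forall n, b n * a 0%N <= a n * b 0%N.
Proof.
move=> a0 ab; elim=> [|n IH]; first by rewrite mulrC.
rewrite -(ler_pM2r (a0 n)) mulrAC.
apply: (le_trans (ler_wpM2r (ltW (a0 0%N)) (ab n))).
rewrite -mulrA [leRHS]mulrAC -[leRHS]mulrA ler_wpM2l ?(ltW (a0 _)) //.
Qed.

Lemma cocycle_iter_orbit (R : realType) m alpha (A : R -> 'M[R[i]]_m) N theta
    (x : nat -> 'cV[R[i]]_m) :
  (forall j, (j < N)%N -> x j.+1 = A (theta + j%:R * alpha) *m x j) ->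
  cocycle_iter alpha A N theta *m x 0%N = x N.
Proof.
elim: N => [|N IH] xA; first by rewrite mul1mx.
by rewrite /= -mulmxA IH ?xA // => j jN; apply: xA; rewrite ltnS ltnW.
Qed.

Lemma cocycle_iterD (R : realType) m alpha (A : R -> 'M[R[i]]_m) p q theta :
  cocycle_iter alpha A (p + q) theta =
  cocycle_iter alpha A q (theta + p%:R * alpha) *m cocycle_iter alpha A p theta.
Proof.
elim: q => [|q IH]; first by rewrite addn0 mul1mx.
by rewrite addnS /= IH mulmxA natrD mulrDl addrA.
Qed.

(** Both vectors are normalised and the inequality is rescaled; it becomes weak so as to include
    zero vectors. *)
Lemma domination_scaled (R : realType) m k l (Ep Em : R -> 'cV[R[i]]_m -> Prop)
    (B : 'M[R[i]]_m) theta u w :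
  cont_subbundle k Ep -> cont_subbundle l Em ->
  (forall u w, Ep theta u -> Em theta w -> hnorm u = 1 -> hnorm w = 1 ->
    hnorm (B *m w) < hnorm (B *m u)) ->
  Ep theta u -> Em theta w -> hnorm (B *m w) * hnorm u <= hnorm (B *m u) * hnorm w.
Proof.
move=> cp cm dom Eu Ew.
have [->|u0] := eqVneq u 0; first by rewrite mulmx0 hnorm0 mulr0 mul0r.
have [->|w0] := eqVneq w 0; first by rewrite mulmx0 hnorm0 mulr0 mul0r.
have unit_scale (z : 'cV[R[i]]_m) : z != 0 ->
    hnorm (((hnorm z)^-1)%:C%C *: z) = 1.
  move=> /hnorm_gt0 z0; rewrite hnormZ normc_real ger0_norm ?invr_ge0 ?hnorm_ge0 //.
  by rewrite mulVf // gt_eqF.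
have := dom _ _ (cont_subbundleZ (((hnorm u)^-1)%:C)%C cp Eu)
  (cont_subbundleZ (((hnorm w)^-1)%:C)%C cm Ew) (unit_scale _ u0) (unit_scale _ w0).
rewrite -!scalemxAr !hnormZ !normc_real !ger0_norm ?invr_ge0 ?hnorm_ge0 //.
move: (hnorm_gt0 u0) (hnorm_gt0 w0) => {}u0 {}w0 /ltW.
by rewrite ler_pdivrMl // mulrA [_ * _^-1]mulrC mulrAC -mulrA ler_pdivlMl // mulrC.
Qed.

Section DualOrbits.
Variable R : realType.
Local Notation C := R[i].
Variables (d : nat) (v : int -> C) (E alpha : R).
Hypothesis vN : forall k, (`|k| <= d)%N -> v (- k) = (v k)^*%C.
Hypotheses (d1 : (1 <= d)%N) (vd : v d%:Z != 0).
Local Notation A := (dual_mat d v E).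
Local Notation wronskian := (@wronskian _ d v).

Lemma wronskian_mx_dual_unit : wronskian_mx d v \in unitmx.
Proof. by apply: wronskian_mx_unit; rewrite // vN ?absz_nat // conjc_eq0. Qed.

Lemma wronskian_nondeg x : (forall y, wronskian x y = 0) -> x = 0.
Proof.
move=> x0; apply: trmx_inj; rewrite trmx0.
apply: (@row_free_inj _ _ _ _ (wronskian_mx d v)).
  by rewrite row_free_unit wronskian_mx_dual_unit.
rewrite mul0mx; apply/rowP => q; rewrite mxE [RHS]mxE -[RHS](x0 (delta_mx q 0)).
apply: eq_bigr => p _; rewrite (bigD1 q) //= big1 => [|i iq].
  by rewrite !mxE !eqxx conjc1 mulr1 addr0 mulrC.
by rewrite !mxE (negPf iq) conjc0 !mulr0.
Qed.

(** A map preserving a nondegenerate form is injective. *)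
Lemma dual_mat_inj theta (x : 'cV[C]_(d.*2)) : A theta *m x = 0 -> x = 0.
Proof.
move=> Ax; apply: wronskian_nondeg => y; rewrite -(wronskian_dual_mat vN d1 vd E theta) Ax.
by apply: big1 => p _; apply: big1 => q _; rewrite [X in _ * (X * _)]mxE mul0r mulr0.
Qed.

Lemma wronskian_bound x y :
  normc (wronskian x y) <= mxnorm1 (wronskian_mx d v) * (hnorm x * hnorm y).
Proof.
apply: (le_trans (le_normc_sum _ _ _)); rewrite /mxnorm1 mulr_suml; apply: ler_sum => p _.
apply: (le_trans (le_normc_sum _ _ _)); rewrite mulr_suml; apply: ler_sum => q _.
rewrite normcM ler_wpM2l ?normc_ge0 // normcM normc_conj.
by rewrite ler_pM ?normc_ge0 ?normc_le_hnorm.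
Qed.

(** The constant value is bounded by a multiple of the product of the norms, which tends to 0. The
    index may stand for either time direction. *)
Lemma wronskian_decay (x y : nat -> 'cV[C]_(d.*2)) c :
  (forall n, wronskian (x n) (y n) = c) ->
  (fun n => hnorm (x n)) @ \oo --> 0 -> (fun n => hnorm (y n)) @ \oo --> 0 -> c = 0.
Proof.
move=> xyc x0 y0; apply: eq0_normc; apply/eqP; rewrite eq_le normc_ge0 andbT.
have lim0 : mxnorm1 (wronskian_mx d v) * (hnorm (x n) * hnorm (y n)) @[n --> \oo] --> 0.
  by rewrite -[X in _ --> X](mulr0 (mxnorm1 (wronskian_mx d v))) -[X in _ * X](mulr0 0);
    apply: cvgM; [exact: cvg_cst|exact: cvgM].
rewrite -(cvg_lim (@Rhausdorff R) lim0); apply: limr_ge; first by apply/cvg_ex; exists 0.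
by apply: nearW => n; rewrite -(xyc n) wronskian_bound.
Qed.

Definition dual_orbit (x : int -> 'cV[C]_(d.*2)) :=
  forall n, x (n + 1) = A (n%:~R * alpha) *m x n.

(** Forwards by linearity, backwards by injectivity of the matrices. *)
Lemma dual_orbit_eq0 x : dual_orbit x -> x 0 = 0 -> forall n, x n = 0.
Proof.
move=> xA x0; elim/int_ind => [//|n IH|n IH].
  by rewrite (_ : n.+1%:Z = n%:Z + 1) ?xA ?IH ?mulmx0 //; lia.
apply: (@dual_mat_inj ((- n.+1%:Z)%:~R * alpha)); rewrite -xA -[RHS]IH; congr x; lia.
Qed.

Lemma subseq_cvg0 (u : nat -> R) N : (1 <= N)%N -> u @ \oo --> 0 ->
  (fun n => u (n * N)%N) @ \oo --> 0.
Proof.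
move=> N1 u0; apply: cvg_comp u0; apply/cvgnyPge => M; near=> n.
have Mn : (M <= n)%N by near: n; exists M.
by rewrite (leq_trans Mn) // leq_pmulr.
Unshelve. all: by end_near. Qed.

(** * Orbits relative to the dominated splitting *)

Section Dominated.
Variables (Ep Em : R -> 'cV[C]_(d.*2) -> Prop) (N : nat).
Hypothesis per : forall theta, Ep (theta + 1) = Ep theta /\ Em (theta + 1) = Em theta.
Hypotheses (cp : cont_subbundle d.+1 Ep) (cm : cont_subbundle (d.*2 - d.+1) Em).
Hypothesis decomp : forall theta (w : 'cV[C]_(d.*2)),
  exists u v, Ep theta u /\ Em theta v /\ w = u + v.
Hypothesis trivI : forall theta u, Ep theta u -> Em theta u -> u = 0.
Hypothesis invp : forall theta u,
  Ep (theta + alpha) u <-> exists2 u', Ep theta u' & u = A theta *m u'.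
Hypothesis invm : forall theta u,
  Em (theta + alpha) u <-> exists2 u', Em theta u' & u = A theta *m u'.
Hypothesis N1 : (1 <= N)%N.
Hypothesis dom : forall theta u w, Ep theta u -> Em theta w -> hnorm u = 1 -> hnorm w = 1 ->
  hnorm (cocycle_iter alpha A N theta *m w) < hnorm (cocycle_iter alpha A N theta *m u).

Lemma domination theta u w : Ep theta u -> Em theta w ->
  hnorm (cocycle_iter alpha A N theta *m w) * hnorm u <=
  hnorm (cocycle_iter alpha A N theta *m u) * hnorm w.
Proof. by apply: (domination_scaled cp cm) => ? ?; exact: dom. Qed.

(** Here [w n] is the state at time [-n], so [N] forward steps from time [-(n + 1) N] end at time
    [-n N]. *)
Lemma cocycle_iter_backward (w : nat -> 'cV[C]_(d.*2)) n :
  (forall n, A (- n.+1%:R * alpha) *m w n.+1 = w n) ->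
  cocycle_iter alpha A N (- (n.+1 * N)%:R * alpha) *m w (n.+1 * N)%N = w (n * N)%N.
Proof.
move=> wA.
have -> : w (n * N)%N = w (n.+1 * N - N)%N by rewrite mulSn addKn.
rewrite -[X in w X](subn0 (n.+1 * N)).
apply: (cocycle_iter_orbit (x := fun j => w (n.+1 * N - j)%N)) => j jN.
have -> : (n.+1 * N - j = (n.+1 * N - j.+1).+1)%N by nia.
rewrite -wA; congr (A _ *m _).
set r := (n.+1 * N - j.+1)%N; have -> : (n.+1 * N = r.+1 + j)%N by rewrite /r; nia.
by rewrite -mulrDl natrD opprD subrK.
Qed.

(* Otherwise the [Em]-component of the orbit decays backwards, hence so does all of [Ep], which would be isotropic of dimension [d + 1]. *)
Lemma backward_decay_mem z : dual_orbit z ->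
  (fun n : nat => hnorm (z (- n%:Z))) @ \oo --> 0 -> Ep 0 (z 0).
Proof.
move=> zA z0.
have [K HK] := splitting_bound cp cm trivI per.
have zbA n : A (- n.+1%:R * alpha) *m z (- n.+1%:Z) = z (- n%:Z).
  rewrite (_ : - n%:Z = - n.+1%:Z + 1) ?zA ?mulrNz //; lia.
have stepE n : - n%:R * alpha = - n.+1%:R * alpha + alpha :> R.
  by rewrite -natr1; ring.
have /choice [pq Hpq] : forall n : nat, exists pq : 'cV[C]_(d.*2) * 'cV[C]_(d.*2),
    Ep (- n%:R * alpha) pq.1 /\ Em (- n%:R * alpha) pq.2 /\ z (- n%:Z) = pq.1 + pq.2.
  by move=> n; have [p [q H]] := decomp (- n%:R * alpha) (z (- n%:Z)); exists (p, q).
pose q n := (pq n).2.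
(* Invariance of both subbundles and uniqueness of the decomposition make the [Em]-components a
   backward orbit. *)
have qA n : A (- n.+1%:R * alpha) *m q n.+1 = q n.
  have [p0 [q0 zn]] := Hpq n; have [p1 [q1 zn1]] := Hpq n.+1.
  have := zbA n; rewrite zn zn1 mulmxDr => eqA.
  have eqB : A (- n.+1%:R * alpha) *m q n.+1 - q n =
      (pq n).1 - A (- n.+1%:R * alpha) *m (pq n.+1).1.
    by apply/eqP; rewrite subr_eq addrAC eq_sym subr_eq -/(q n) -eqA addrC.
  apply/eqP; rewrite -subr_eq0; apply/eqP; apply: (trivI (theta := - n%:R * alpha)).
    rewrite eqB -[- (A _ *m _)]scaleN1r; apply: (cont_subbundleD cp) => //.
    by apply: (cont_subbundleZ _ cp); rewrite stepE; apply/invp; exists (pq n.+1).1.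
  rewrite -[- q n]scaleN1r; apply: (cont_subbundleD cm).
    by rewrite stepE; apply/invm; exists (q n.+1).
  exact: (cont_subbundleZ _ cm).
have [q0|/eqP q0] := eqVneq (q 0%N) 0.
  by have := Hpq 0%N; rewrite oppr0 mul0r -/(q 0%N) q0 addr0 => -[+ [_ ->]].
have qn n : q n != 0.
  elim: n => [|n IH]; first exact/eqP.
  by apply: contra IH => /eqP qn; rewrite -qA qn mulmx0.
(* By invariance every vector of [Ep 0] has a backward orbit inside [Ep]; it is followed in blocks
   of [N] steps. *)
have backward w : Ep 0 w -> exists wb : nat -> 'cV[C]_(d.*2), [/\ wb 0%N = w,
    forall n, A (- n.+1%:R * alpha) *m wb n.+1 = wb n &
    (fun n => hnorm (wb (n * N)%N)) @ \oo --> 0].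
  move=> Ew.
  (* The value off the fibre is a placeholder; the sequence [wb] stays in [Ep]. *)
  have /choice [g Hg] : forall nu : nat * 'cV[C]_(d.*2), exists u',
      Ep (- nu.1%:R * alpha) nu.2 -> Ep (- nu.1.+1%:R * alpha) u' /\
      A (- nu.1.+1%:R * alpha) *m u' = nu.2.
    move=> [n u] /=; have [Eu|nEu] := pselect (Ep (- n%:R * alpha) u); last by exists 0.
    by move: (Eu); rewrite stepE => /invp [u' Eu' ->]; exists u'.
  pose wb := fix wb n := if n is n'.+1 then g (n', wb n') else w.
  have wbE n : Ep (- n%:R * alpha) (wb n).
    elim: n => [|n IH]; first by rewrite oppr0 mul0r.
    by have [] := Hg (n, wb n) IH.
  have wbA n : A (- n.+1%:R * alpha) *m wb n.+1 = wb n.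
    by have [] := Hg (n, wb n) (wbE n).
  exists wb; split => //.
  (* Domination from time [-n N] to time 0 bounds [wb] by a multiple of [q], and transversality
     bounds [q] by [K] times the orbit [z]. *)
  have le n : hnorm (wb (n * N)%N) <=
      hnorm w / hnorm (q 0%N) * K * hnorm (z (- (n * N)%:Z)).
    have H : hnorm (wb (n * N)%N) * hnorm (q (0 * N)%N) <=
        hnorm (q (n * N)%N) * hnorm (wb (0 * N)%N).
      apply: (ratio_le (a := fun n => hnorm (q (n * N)%N))
        (b := fun n => hnorm (wb (n * N)%N))) => {}n; first exact: hnorm_gt0.
      have [_ [Eq _]] := Hpq (n.+1 * N)%N.
      have := domination (wbE (n.+1 * N)%N) Eq.
      by rewrite (cocycle_iter_backward _ wbA) (cocycle_iter_backward _ qA) mulrC [leRHS]mulrC.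
    rewrite mul0n in H.
    rewrite (_ : _ * hnorm (z _) =
      K * hnorm (z (- (n * N)%:Z)) * hnorm w / hnorm (q 0%N)); last ring.
    rewrite ler_pdivlMr ?(hnorm_gt0 (qn 0%N)) //.
    apply: (le_trans H).
    rewrite ler_wpM2r ?hnorm_ge0 //.
    by have [Ep0 [Eq ->]] := Hpq (n * N)%N; exact: (HK _ _ _ Ep0 Eq).
  apply: (@squeeze_cvgr _ _ _ _ (fun=> 0)
    (fun n => hnorm w / hnorm (q 0%N) * K * hnorm (z (- (n * N)%:Z)))
    (fun n => hnorm (wb (n * N)%N))).
  - by apply: nearW => n; rewrite hnorm_ge0 le.
  - exact: cvg_cst.
  - rewrite -[X in _ --> X](mulr0 (hnorm w / hnorm (q 0%N) * K)).
    by apply: cvgMr; apply: (subseq_cvg0 (u := fun n : nat => hnorm (z (- n%:Z)))).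
have iso u w : Ep 0 u -> Ep 0 w -> wronskian u w = 0.
  move=> /backward [ub [u0 uA ulim]] /backward [wb [w0 wA wlim]].
  apply: (wronskian_decay _ ulim wlim) => n; elim: (n * N)%N => [|k IH].
    by rewrite u0 w0.
  by rewrite -(wronskian_dual_mat vN d1 vd E (- k.+1%:R * alpha)) uA wA.
(* A frame of [Ep 0] has [d + 1] columns, one more than isotropy allows. *)
have [F [rF FE]] := cont_subbundleP 0 cp.
suff : (d.+1 <= d)%N by rewrite ltnn.
apply: (isotropic_rank (W := F)) wronskian_mx_dual_unit _ rF => i j.
by apply: iso; apply/FE; eexists; rewrite colE.
Qed.

Local Notation forward n u := (cocycle_iter alpha A n 0 *m u).

Lemma cocycle_iterS n (u : 'cV[C]_(d.*2)) : forward n.+1 u = A (n%:R * alpha) *m forward n u.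
Proof. by rewrite /= add0r mulmxA. Qed.

Lemma forward_orbit z (n : nat) : dual_orbit z -> forward n (z 0) = z n.
Proof.
move=> zA; apply: (cocycle_iter_orbit (x := fun n : nat => z n)) => j _.
by rewrite add0r (_ : j.+1%:Z = j%:Z + 1) ?zA //; lia.
Qed.

Lemma forward_isotropic u w :
  (fun n => hnorm (forward (n * N) u)) @ \oo --> 0 ->
  (fun n => hnorm (forward (n * N) w)) @ \oo --> 0 -> wronskian u w = 0.
Proof.
move=> u0 w0; apply: (wronskian_decay _ u0 w0) => n.
elim: (n * N)%N => [|k IH]; first by rewrite !mul1mx.
by rewrite !cocycle_iterS wronskian_dual_mat.
Qed.

(** Domination in forward time bounds the orbit of [u] in [Em] by a multiple of the orbit [z] in
    [Ep], so the decay of [z] passes to [u]. *)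
Lemma forward_decay z u : dual_orbit z -> z 0 != 0 -> Ep 0 (z 0) -> Em 0 u ->
  (fun n : nat => hnorm (z n)) @ \oo --> 0 ->
  (fun n => hnorm (forward (n * N) u)) @ \oo --> 0.
Proof.
move=> zA z0 Ez Eu zlim.
have stepE n : n.+1%:R * alpha = n%:R * alpha + alpha :> R by rewrite -natr1; ring.
have zE (n : nat) : Ep (n%:R * alpha) (forward n (z 0)).
  elim: n => [|n IH]; first by rewrite mul0r mul1mx.
  by rewrite stepE cocycle_iterS; apply/invp; exists (forward n (z 0)).
have uE (n : nat) : Em (n%:R * alpha) (forward n u).
  elim: n => [|n IH]; first by rewrite mul0r mul1mx.
  by rewrite stepE cocycle_iterS; apply/invm; exists (forward n u).
have zn0 (n : nat) : forward n (z 0) != 0.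
  elim: n => [|n]; first by rewrite mul1mx.
  by apply: contra => /eqP h; rewrite cocycle_iterS in h; rewrite (dual_mat_inj h).
have iterM (n : nat) (w : 'cV[C]_(d.*2)) : forward (n.+1 * N) w =
    cocycle_iter alpha A N ((n * N)%:R * alpha) *m forward (n * N) w.
  by rewrite mulSn addnC cocycle_iterD add0r mulmxA.
have le n : hnorm (forward (n * N) u) <= hnorm u / hnorm (z 0) * hnorm (z (n * N)%N).
  have H : hnorm (forward (n * N) u) * hnorm (forward (0 * N) (z 0)) <=
      hnorm (forward (n * N) (z 0)) * hnorm (forward (0 * N) u).
    apply: (ratio_le (a := fun n => hnorm (forward (n * N) (z 0)))
      (b := fun n => hnorm (forward (n * N) u))) => {}n; first exact: hnorm_gt0.
    by rewrite !iterM; exact: domination.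
  rewrite !mul0n !mul1mx forward_orbit // in H.
  rewrite (_ : _ * hnorm (z _) = hnorm (z (n * N)%N) * hnorm u / hnorm (z 0)); last ring.
  by rewrite ler_pdivlMr // hnorm_gt0.
apply: (@squeeze_cvgr _ _ _ _ (fun=> 0)
  (fun n => hnorm u / hnorm (z 0) * hnorm (z (n * N)%N))).
- by apply: nearW => n; rewrite hnorm_ge0 le.
- exact: cvg_cst.
- rewrite -[X in _ --> X](mulr0 (hnorm u / hnorm (z 0))).
  by apply: cvgMr; apply: (subseq_cvg0 (u := fun n : nat => hnorm (z n))).
Qed.

(* The two orbits dominate [Em], so together with [Em] they would span an isotropic space of dimension [d + 1]. *)
Lemma decaying_orbits_dependent x y : dual_orbit x -> dual_orbit y ->
  (fun n : nat => hnorm (x n)) @ \oo --> 0 -> (fun n : nat => hnorm (x (- n%:Z))) @ \oo --> 0 ->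
  (fun n : nat => hnorm (y n)) @ \oo --> 0 -> (fun n : nat => hnorm (y (- n%:Z))) @ \oo --> 0 ->
  exists2 c : C * C, c != (0, 0) & c.1 *: x 0 + c.2 *: y 0 = 0.
Proof.
move=> xA yA xp xm yp ym; apply: contrapT => indep.
have ind c1 c2 : c1 *: x 0 + c2 *: y 0 = 0 -> c1 = 0 /\ c2 = 0.
  move=> H; have [[-> ->] //|n0] := eqVneq (c1, c2) (0, 0).
  by case: indep; exists (c1, c2).
have Ex := backward_decay_mem xA xm; have Ey := backward_decay_mem yA ym.
have x0 : x 0 != 0.
  apply/eqP => x0; have [] := ind 1 0; first by rewrite x0 scaler0 scale0r addr0.
  by move/eqP; rewrite oner_eq0.
have xlim : (fun n => hnorm (forward (n * N) (x 0))) @ \oo --> 0.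
  under [X in X @ _]eq_fun do rewrite forward_orbit //.
  exact: (subseq_cvg0 (u := fun n : nat => hnorm (x n))).
have ylim : (fun n => hnorm (forward (n * N) (y 0))) @ \oo --> 0.
  under [X in X @ _]eq_fun do rewrite forward_orbit //.
  exact: (subseq_cvg0 (u := fun n : nat => hnorm (y n))).
have [G [rG EG]] := cont_subbundleP 0 cm.
pose W := row_mx G (row_mx (x 0) (y 0)).
have Wlim j : (fun n => hnorm (forward (n * N) (col j W))) @ \oo --> 0.
  case: (split_ordP j) => {}j ->.
    rewrite colKl; apply: (forward_decay xA) => //.
    by apply/EG; rewrite colE; eexists.
  rewrite colKr; case: (split_ordP j) => {}j ->; rewrite ?colKl ?colKr ord1 col_id.
    exact: xlim.
  exact: ylim.
have rW : \rank W = (d.*2 - d.+1 + (1 + 1))%N.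
  rewrite -mxrank_tr; apply/eqP; apply: inj_row_free => w W0.
  have Ww : W *m w^T = 0 by apply: trmx_inj; rewrite trmx_mul trmxK W0 trmx0.
  move: Ww; rewrite -[w^T]vsubmxK -[dsubmx w^T]vsubmxK !mul_row_col.
  set c := usubmx w^T; set e1 := usubmx _; set e2 := dsubmx _ => H.
  have [a1 e1E] : exists a, e1 = a%:M by exists (e1 0 0); rewrite -mx11_scalar.
  have [a2 e2E] : exists a, e2 = a%:M by exists (e2 0 0); rewrite -mx11_scalar.
  (* [G *m c] is in [Em 0] and, by the relation, is a combination of [x 0] and [y 0], which are in
     [Ep 0]. *)
  have Gc : G *m c = 0.
    apply: (trivI (theta := 0)); last by apply/EG; eexists.
    have -> : G *m c = (- a1) *: x 0 + (- a2) *: y 0.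
      move/eqP: H; rewrite e1E e2E !mul_mx_scalar addr_eq0 opprD => /eqP ->.
      by rewrite !scaleNr.
    by apply: (cont_subbundleD cp); apply: (cont_subbundleZ _ cp).
  move: H; rewrite Gc add0r e1E e2E !mul_mx_scalar => /ind [a10 a20].
  apply: trmx_inj; rewrite trmx0 -[w^T]vsubmxK -[dsubmx w^T]vsubmxK.
  rewrite -/c -/e1 -/e2 e1E e2E a10 a20 (full_col_rank_inj rG Gc).
  by rewrite !raddf0 !col_mx0.
have /(isotropic_rank wronskian_mx_dual_unit) : forall i j, wronskian (col i W) (col j W) = 0.
  by move=> i j; exact: forward_isotropic.
(* As [d >= 1], the number of columns [2d - (d + 1) + 2] equals [d + 1]. *)
by move/(_ rW); lia.
Qed.
End Dominated.
End DualOrbits.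

(** * Means along an ultrafilter and the Bessel inequality *)

Lemma ultra_fmap (T U : Type) (f : T -> U) (F : set_system T) :
  UltraFilter F -> UltraFilter (f x @[x --> F]).
Proof.
move=> FU; split; first exact: fmap_proper_filter.
move=> G GF FG; rewrite predeqE => A; split; last exact: FG.
move=> GA; have [//|FnA] := in_ultra_setVsetC (f @^-1` A) FU.
have /FG GnA : (f x @[x --> F]) (~` A) by [].
by have /filter_ex [? []] : G (A `&` ~` A) by exact: filterI.
Qed.

Section RealMean.
Variable R : realType.
Implicit Types s t : nat -> R.

(** It refines the filter at infinity, so ordinary limits are kept. *)
Definition free_ultrafilter : set_system nat :=
  projT1 (cid (ultraFilterLemma eventually_filter)).

Lemma free_ultrafilter_ultra : UltraFilter free_ultrafilter.
Proof. by rewrite /free_ultrafilter; case: cid => U []. Qed.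
Local Existing Instance free_ultrafilter_ultra.

Lemma free_ultrafilter_cvg s (l : R) : s @ \oo --> l -> s @ free_ultrafilter --> l.
Proof.
move=> sl A /sl; rewrite /free_ultrafilter; case: cid => U [_ oU] /=; exact: oU.
Qed.

Definition cesaro s (n : nat) : R := (\sum_(j < n) s j) / n%:R.

(* Along an ultrafilter the Cesaro averages of every bounded sequence converge. *)
Definition mean s : R := lim (cesaro s n @[n --> free_ultrafilter]).

Definition bounded_seq s := exists K, forall n, `|s n| <= K.

(** The averages stay in a compact interval, where the image ultrafilter must converge. *)
Lemma cvg_mean s : bounded_seq s -> cesaro s n @[n --> free_ultrafilter] --> mean s.
Proof.
case=> K sK.
have K0 : 0 <= K by rewrite (le_trans _ (sK 0%N)).
have cK n : `|cesaro s n| <= K.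
  rewrite /cesaro normrM normfV normr_nat.
  case: n => [|n]; first by rewrite invr0 mulr0.
  rewrite ler_pdivrMr ?ltr0n // (le_trans (ler_norm_sum _ _ _)) //.
  rewrite mulr_natr -[in leRHS](card_ord n.+1) -sumr_const.
  by apply: ler_sum => i _.
have : compact `[- K, K]%classic by exact: segment_compact.
rewrite compact_ultra => /(_ (cesaro s n @[n --> free_ultrafilter])).
case=> [||l [_ sl]]; last by apply/cvg_ex; exists l.
  exact: ultra_fmap.
by apply: (@filterE _ free_ultrafilter) => n; rewrite /= in_itv /= -ler_norml.
Qed.

Lemma mean_eq s l : cesaro s @ \oo --> l -> mean s = l.
Proof. by move=> /free_ultrafilter_cvg /(cvg_lim (@Rhausdorff R)). Qed.

Lemma bounded_seqD s t : bounded_seq s -> bounded_seq t -> bounded_seq (s \+ t).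
Proof.
by move=> [K sK] [L tL]; exists (K + L) => n; rewrite (le_trans (ler_normD _ _)) ?lerD.
Qed.

Lemma bounded_seqZ c s : bounded_seq s -> bounded_seq (fun n => c * s n).
Proof. by move=> [K sK]; exists (`|c| * K) => n; rewrite normrM ler_wpM2l. Qed.

Lemma meanD s t : bounded_seq s -> bounded_seq t -> mean (s \+ t) = mean s + mean t.
Proof.
move=> sb tb; apply: (cvg_lim (@Rhausdorff R)).
rewrite (_ : cesaro _ = cesaro s \+ cesaro t).
  by apply: cvgD; exact: cvg_mean.
by apply/funext => n; rewrite /cesaro big_split mulrDl.
Qed.

Lemma meanZ c s : bounded_seq s -> mean (fun n => c * s n) = c * mean s.
Proof.
move=> sb; apply: (cvg_lim (@Rhausdorff R)).
rewrite (_ : cesaro _ = fun n => c * cesaro s n).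
  by apply: cvgMr; exact: cvg_mean.
by apply/funext => n; rewrite /cesaro -mulr_sumr mulrA.
Qed.

Lemma mean_ge0 s : bounded_seq s -> (forall n, 0 <= s n) -> 0 <= mean s.
Proof.
move=> sb s0; rewrite /mean; apply: limr_ge.
  by apply/cvg_ex; exists (mean s); exact: cvg_mean.
by apply: nearW => n; rewrite divr_ge0 ?sumr_ge0.
Qed.

Lemma le_mean s t : bounded_seq s -> bounded_seq t -> (forall n, s n <= t n) ->
  mean s <= mean t.
Proof.
move=> sb tb st; have Nsb := bounded_seqZ (-1) sb.
rewrite -subr_ge0 -[- mean s]mulN1r -(meanZ _ sb) -(meanD tb Nsb).
by apply: mean_ge0 => [|n]; [exact: bounded_seqD|rewrite /= mulN1r subr_ge0].
Qed.

Lemma cvg_divn (s : nat -> R) : bounded_seq s -> (fun n => s n / n%:R) @ \oo --> 0.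
Proof.
move=> [K sK]; apply/cvgr0Pnorm_le => e e0; near=> n.
have n0 : (0 < n)%N by near: n; exists 1%N.
rewrite normrM normfV normr_nat ler_pdivrMr ?ltr0n // (le_trans (sK n)) //.
rewrite mulrC -ler_pdivrMr //; near: n; exact: nbhs_infty_ger.
Unshelve. all: by end_near. Qed.

(** Telescoping: the two averages differ by [(s n - s 0) / n], which tends to 0. *)
Lemma mean_shift s : bounded_seq s -> mean (fun n => s n.+1) = mean s.
Proof.
move=> sb; apply: (cvg_lim (@Rhausdorff R)); rewrite -[mean s]addr0.
rewrite (_ : cesaro _ = cesaro s \+ (fun n => (s n - s 0%N) / n%:R)).
  apply: cvgD; first exact: cvg_mean.
  apply: free_ultrafilter_cvg; apply: cvg_divn.
  case: sb => K sK; exists (K + K) => n.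
  by rewrite (le_trans (ler_normB _ _)) ?lerD.
apply/funext => n; rewrite /cesaro /= -mulrDl; congr (_ / _).
elim: n => [|n IH]; first by rewrite !big_ord0; ring.
by rewrite !big_ord_recr /= IH; ring.
Qed.

Lemma mean_cst c : mean (fun=> c) = c.
Proof.
apply: mean_eq; apply: (cvg_near_cst); near=> n.
have n0 : (0 < n)%N by near: n; exists 1%N.
by rewrite /cesaro sumr_const card_ord -[c *+ n]mulr_natr mulfK // pnatr_eq0 -lt0n.
Unshelve. all: by end_near. Qed.
End RealMean.

Section ComplexMean.
Variable R : realType.
Local Notation C := R[i].
Implicit Types s t : nat -> C.

Definition cmean s : C := (mean (@complex.Re R \o s) +i* mean (@complex.Im R \o s))%C.

Definition cbounded s := exists K, forall n, normc (s n) <= K.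

Lemma cbounded_Re s : cbounded s -> bounded_seq (@complex.Re R \o s).
Proof. by move=> [K sK]; exists K => n; rewrite (le_trans (Re_le_normc _)). Qed.

Lemma cbounded_Im s : cbounded s -> bounded_seq (@complex.Im R \o s).
Proof. by move=> [K sK]; exists K => n; rewrite (le_trans (Im_le_normc _)). Qed.

Lemma cbounded_cst c : cbounded (fun=> c).
Proof. by exists (normc c). Qed.

Lemma cboundedD s t : cbounded s -> cbounded t -> cbounded (s \+ t).
Proof.
by move=> [K sK] [L tL]; exists (K + L) => n; rewrite (le_trans (le_normcD _ _)) ?lerD.
Qed.

Lemma cboundedM s t : cbounded s -> cbounded t -> cbounded (fun n => s n * t n).
Proof.
move=> [K sK] [L tL]; exists (K * L) => n; rewrite normcM.
by apply: ler_pM; rewrite ?normc_ge0.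
Qed.

Lemma cboundedZ c s : cbounded s -> cbounded (fun n => c * s n).
Proof. exact/cboundedM/cbounded_cst. Qed.

Lemma cbounded_conj s : cbounded s -> cbounded (fun n => (s n)^*%C).
Proof. by move=> [K sK]; exists K => n; rewrite normc_conj. Qed.

Lemma cbounded_sum I (r : seq I) (s : I -> nat -> C) :
  (forall i, cbounded (s i)) -> cbounded (fun n => \sum_(i <- r) s i n).
Proof.
move=> sb; elim: r => [|i r IH].
  by exists 0 => n; rewrite big_nil normc0.
have [K HK] := cboundedD (sb i) IH.
by exists K => n; rewrite big_cons; exact: HK.
Qed.

Lemma cmean_eq s t : s =1 t -> cmean s = cmean t.
Proof. by move=> /funext ->. Qed.

Lemma cmeanD s t : cbounded s -> cbounded t -> cmean (s \+ t) = cmean s + cmean t.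
Proof.
move=> sb tb; rewrite /cmean; congr (_ +i* _)%C.
  rewrite -(meanD (cbounded_Re sb) (cbounded_Re tb)).
  by congr mean; apply/funext => n; exact: complex_ReD.
rewrite -(meanD (cbounded_Im sb) (cbounded_Im tb)).
by congr mean; apply/funext => n; exact: complex_ImD.
Qed.

Lemma cmeanZ c s : cbounded s -> cmean (fun n => c * s n) = c * cmean s.
Proof.
move=> sb; have rb := cbounded_Re sb; have ib := cbounded_Im sb.
case: c => a b; rewrite /cmean; simpc; congr (_ +i* _)%C.
  rewrite -mulNr -(meanZ a rb) -(meanZ (- b) ib) -meanD ?bounded_seqZ //; last 2 first.
  - exact: bounded_seqZ.
  - exact: bounded_seqZ.
  by congr mean; apply/funext => n; rewrite /= complex_ReM /= mulNr.
rewrite -(meanZ a ib) -(meanZ b rb) -meanD ?bounded_seqZ //; last 2 first.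
- exact: bounded_seqZ.
- exact: bounded_seqZ.
by congr mean; apply/funext => n; rewrite /= complex_ImM.
Qed.

Lemma cmean_cst c : cmean (fun=> c) = c.
Proof. by rewrite /cmean /comp !mean_cst; case: c. Qed.

Lemma cmean_sum I (r : seq I) (s : I -> nat -> C) :
  (forall i, cbounded (s i)) ->
  cmean (fun n => \sum_(i <- r) s i n) = \sum_(i <- r) cmean (s i).
Proof.
move=> sb; elim: r => [|i r IH].
  by rewrite big_nil -[RHS]cmean_cst; apply: cmean_eq => n; rewrite big_nil.
rewrite big_cons -IH -cmeanD //; last exact: cbounded_sum.
by apply: cmean_eq => n; rewrite big_cons.
Qed.

Lemma cmean_shift s : cbounded s -> cmean (fun n => s n.+1) = cmean s.
Proof.
move=> sb; rewrite /cmean; congr (_ +i* _)%C.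
  exact: (mean_shift (cbounded_Re sb)).
exact: (mean_shift (cbounded_Im sb)).
Qed.

Lemma cmean_conj s : cbounded s -> cmean (fun n => (s n)^*%C) = (cmean s)^*%C.
Proof.
move=> sb; rewrite /cmean; congr (_ +i* _)%C.
  by congr mean; apply/funext => n /=; case: (s n).
rewrite -mulN1r -(meanZ _ (cbounded_Im sb)).
by congr mean; apply/funext => n /=; rewrite mulN1r; case: (s n).
Qed.

(** Shift invariance gives [c = z * c] for the mean [c]. *)
Lemma cmean_unit_power (z : C) : normc z = 1 -> z != 1 -> cmean (fun n => z ^+ n) = 0.
Proof.
move=> z1 zn1; have zb : cbounded (fun n => z ^+ n).
  by exists 1 => n; elim: n => [|n IH]; rewrite ?normc1 // exprS normcM z1 mul1r.
have : cmean (fun n => z ^+ n.+1) = z * cmean (fun n => z ^+ n).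
  by rewrite -(cmeanZ _ zb); apply: cmean_eq => n; rewrite exprS.
rewrite (cmean_shift zb) => /eqP; rewrite eq_sym -subr_eq0 -[X in _ - X]mul1r -mulrBl.
by rewrite mulf_eq0 subr_eq0 (negPf zn1) => /eqP.
Qed.

Definition inner s t := cmean (fun n => s n * (t n)^*%C).

(* Bessel: subtracting [inner s (phi N) * phi N] from the residual lowers its mean square by [normc (inner s (phi N)) ^+ 2]. *)
Lemma bessel s (phi : nat -> nat -> C) : cbounded s ->
  (forall k n, normc (phi k n) = 1) ->
  (forall k l, k != l -> inner (phi k) (phi l) = 0) ->
  forall N, \sum_(k < N) normc (inner s (phi k)) ^+ 2 <= mean (fun n => normc (s n) ^+ 2).
Proof.
move=> sb phi1 orth N.
have pb k : cbounded (phi k) by exists 1 => n; rewrite phi1.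
have pbc k := cbounded_conj (pb k).
have sqb (r : nat -> C) : cbounded r -> bounded_seq (fun n => normc (r n) ^+ 2).
  move=> [K rK]; exists (K ^+ 2) => n; rewrite ger0_norm ?sqr_ge0 //.
  by rewrite ler_sqr ?nnegrE ?normc_ge0 // (le_trans (normc_ge0 _) (rK n)).
(* [r] is the residual after [N] subtractions; by orthogonality its coefficients against the
   remaining [phi k] are those of [s]. *)
have [r [rb rphi rE]] : exists r, [/\ cbounded r,
    forall k, (N <= k)%N -> inner r (phi k) = inner s (phi k) &
    mean (fun n => normc (r n) ^+ 2) =
      mean (fun n => normc (s n) ^+ 2) - \sum_(k < N) normc (inner s (phi k)) ^+ 2].
  elim: N => [|N [r [rb rphi rE]]]; first by exists s; rewrite big_ord0 subr0.
  have [c cE] : exists c, c = inner s (phi N) by eexists.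
  have cb : cbounded (fun n => - c * phi N n) by exact: cboundedZ.
  exists (r \+ (fun n => - c * phi N n)); split; first exact: cboundedD.
    move=> k Nk; rewrite -(rphi k (ltnW Nk)) /inner.
    transitivity (cmean (fun n => r n * (phi k n)^*%C) + - c * inner (phi N) (phi k)).
      rewrite -cmeanZ; last exact: cboundedM.
      have rpk : cbounded (fun n => r n * (phi k n)^*%C) by exact: cboundedM.
      have ppk : cbounded (fun n => - c * (phi N n * (phi k n)^*%C)).
        by apply: cboundedZ; exact: cboundedM.
      rewrite -cmeanD //.
      by apply: cmean_eq => n; rewrite /= mulrDl mulrA.
    by rewrite orth ?mulr0 ?addr0 // neq_ltn Nk.
  rewrite big_ord_recr opprD addrA -rE -cE.
  have rpb : cbounded (fun n => (c^*%C * (r n * (phi N n)^*%C))).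
    by apply: cboundedZ; exact: cboundedM.
  (* The square is expanded with [normc (phi N n) = 1]; the cross term then averages to
     [-2 * normc c ^+ 2]. *)
  transitivity (mean (fun n => normc (r n) ^+ 2) +
      (-2 * mean (@complex.Re R \o (fun n => c^*%C * (r n * (phi N n)^*%C))) +
      mean (fun=> normc c ^+ 2))).
    rewrite -(meanZ _ (cbounded_Re rpb)).
    have H1 := bounded_seqZ (-2) (cbounded_Re rpb).
    have H2 : bounded_seq (fun _ : nat => normc c ^+ 2) by exists (`|normc c ^+ 2|).
    rewrite -(meanD H1 H2) -(meanD (sqb _ rb) (bounded_seqD H1 H2)).
    congr mean; apply/funext => n /=.
    have -> : normc c ^+ 2 = normc c ^+ 2 * normc (phi N n) ^+ 2.
      by rewrite phi1 expr1n mulr1.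
    rewrite !sqr_normc !(complex_ReD, complex_ImD, complex_ReM, complex_ImM,
      complex_ReN, complex_ImN, Re_conjc, Im_conjc); ring.
  rewrite mean_cst.
  have -> : mean (@complex.Re R \o (fun n => c^*%C * (r n * (phi N n)^*%C))) =
      complex.Re (c^*%C * c).
    rewrite [X in _ * X]cE -(rphi N) // /inner -cmeanZ; last exact: cboundedM.
    by [].
  by rewrite [c^*%C * c]mulrC mulc_conj /=; ring.
rewrite -subr_ge0 -rE; apply: mean_ge0 => [|n]; [exact: sqb|exact: sqr_ge0].
Qed.

(** Bessel's inequality bounds the partial sums of squares, so the terms tend to 0. *)
Lemma bessel_cvg0 s (phi : nat -> nat -> C) : cbounded s ->
  (forall k n, normc (phi k n) = 1) ->
  (forall k l, k != l -> inner (phi k) (phi l) = 0) ->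
  (fun k => normc (inner s (phi k))) @ \oo --> 0.
Proof.
move=> sb phi1 orth.
have sq0 : (fun k => normc (inner s (phi k)) ^+ 2) @ \oo --> 0.
  apply: cvg_series_cvg_0; apply: nondecreasing_is_cvgn.
    by apply/nondecreasing_seqP => n; rewrite /series /= big_nat_recr //= lerDl sqr_ge0.
  exists (mean (fun n => normc (s n) ^+ 2)) => _ [N _ <-].
  by rewrite /series /= big_mkord; exact: bessel.
rewrite -(@sqrtr0 R) (_ : (fun k => _) =
    (fun k => Num.sqrt (normc (inner s (phi k)) ^+ 2))); last first.
  by apply/funext => k; rewrite sqrtr_sqr ger0_norm ?normc_ge0.
apply: (@continuous_cvg _ _ _ _ _ _ (@Num.sqrt R)) => //; exact: sqrt_continuous.
Qed.
End ComplexMean.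

(** * Fourier coefficients along the rotation *)

Section Characters.
Variable R : realType.
Local Notation C := R[i].

Definition echar (t : R) : C := (cos (2 * pi * t) +i* sin (2 * pi * t))%C.

Lemma echarD s t : echar (s + t) = echar s * echar t.
Proof. by rewrite /echar mulrDr cosD sinD; simpc; congr (_ +i* _)%C; ring. Qed.

Lemma echarN t : echar (- t) = (echar t)^*%C.
Proof. by rewrite /echar mulrN cosN sinN. Qed.

Lemma echar0 : echar 0 = 1.
Proof. by rewrite /echar mulr0 cos0 sin0. Qed.

Lemma normc_echar t : normc (echar t) = 1.
Proof. by rewrite /= cos2Dsin2 sqrtr1. Qed.

Lemma echarMn (n : nat) t : echar (n%:R * t) = echar t ^+ n.
Proof. by elim: n => [|n IH]; rewrite ?mul0r ?echar0 // -natr1 mulrDl mul1r echarD IH exprSr. Qed.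

Lemma echar1 : echar 1 = 1.
Proof. by rewrite /echar mulr1 mulr_natl cos2pi sin2pi. Qed.

Lemma echarDint t (n : int) : echar (t + n%:~R) = echar t.
Proof. by apply: periodic_int => x; rewrite echarD echar1 mulr1. Qed.

(** For the fractional part [f], [cos (2 * pi * f) = 1] forces [sin (pi * f) = 0], which fails for
    [0 < f < 1]. *)
Lemma echar_eq1 t : echar t = 1 -> exists n : int, t = n%:~R.
Proof.
move=> t1; exists (Num.floor t); have /andP[f0 f1] := floor_itv t.
set f := t - (Num.floor t)%:~R.
have : echar f = 1 by rewrite /f -mulrNz echarDint.
have fge : 0 <= f by rewrite subr_ge0.
have flt : f < 1 by move: f1; rewrite /f intrD; lra.
case=> c1 _; apply/eqP; rewrite -subr_eq0 -/f eq_le fge andbT leNgt; apply/negP => fgt.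
have /sin_gt0_pi s0 : 0 < pi * f < pi.
  by rewrite mulr_gt0 ?pi_gt0 //= gtr_pMr ?pi_gt0.
move: c1; rewrite -mulrA mulr_natl cos_mulr2n => c1.
have : sin (pi * f) ^+ 2 = 0 by rewrite sin2cos2; lra.
by move/eqP; rewrite sqrf_eq0 gt_eqF.
Qed.

Lemma sqr_normc_sub1echar t : normc (1 - echar t) ^+ 2 = 2 - 2 * cos (2 * pi * t).
Proof.
have := cos2Dsin2 (2 * pi * t).
by rewrite sqr_normc !(complex_ReD, complex_ImD, complex_ReN, complex_ImN) /=; nra.
Qed.

Lemma continuous_periodic_bounded (g : R -> R) :
  (forall x, {for x, continuous g}) -> (forall x, g (x + 1) = g x) ->
  exists B, forall x, `|g x| <= B.
Proof.
move=> gc gp.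
have gc' : {within `[0, 1], continuous (fun x => `|g x|)}.
  apply: continuous_subspaceT => x.
  by apply: (continuous_comp (gc x)); exact: norm_continuous.
have [c _ cmax] := EVT_max ler01 gc'.
exists `|g c| => x; have /andP[f0 f1] := floor_itv x.
rewrite -(subrK (Num.floor x)%:~R x) (periodic_int gp); apply: cmax.
by rewrite in_itv /= subr_ge0 f0 /=; move: f1; rewrite intrD; lra.
Qed.

(* Away from the integer translates of [x0] the factor [normc (1 - echar (x - x0))] is bounded below. *)
Lemma periodic_modulus (g : R -> R) (x0 e : R) :
  (forall x, {for x, continuous g}) -> (forall x, g (x + 1) = g x) -> 0 < e ->
  exists2 K, 0 <= K & forall x, `|g x - g x0| <= e + K * normc (1 - echar (x - x0)) ^+ 2.
Proof.
move=> gc gp e0; have [B gB] := continuous_periodic_bounded gc gp.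
have B0 : 0 <= B by rewrite (le_trans _ (gB 0)).
have /cvgrPdist_le /(_ _ e0) := gc x0.
rewrite -nbhs_ballE => -[r r0 rP]; rewrite /= in r0.
pose del := Num.min (r / 2) (1 / 2) : R.
have d0 : 0 < del by rewrite lt_min !divr_gt0.
have dr : del < r by rewrite gt_min; apply/orP; left; lra.
have d2 : del <= 1 / 2 by rewrite ge_min lexx orbT.
have cpos : 0 < 2 - 2 * cos (2 * pi * del) :> R.
  have p0 := pi_gt0 R.
  rewrite subr_gt0 gtr_pMr // lt_neqAle cos_le1 andbT; apply/eqP => c1.
  have : 2 * pi * del = 0 by apply: cos_inj; rewrite ?in_itv /= ?cos0 //; apply/andP; split; nra.
  by nra.
(* [2 * B] bounds every oscillation of [g]; the denominator is the least value of
   [normc (1 - echar t) ^+ 2] for [del <= |t| <= 1/2]. *)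
exists (2 * B / (2 - 2 * cos (2 * pi * del))); first by rewrite divr_ge0 ?mulr_ge0 // ltW.
(* [n] is an integer nearest to [x - x0], so that [|t| <= 1/2]. *)
move=> x; set n := Num.floor (x - x0 + 1/2).
have /andP[f0 f1] := floor_itv (x - x0 + 1/2).
rewrite -/n in f0 f1.
pose t := x - x0 - n%:~R.
have t1 : `|t| <= 1 / 2 by rewrite ler_norml /t; move: f1; rewrite intrD; lra.
have -> : g x = g (x0 + t).
  by rewrite -[RHS](periodic_int gp n); congr g; rewrite /t; ring.
have -> : echar (x - x0) = echar t by rewrite -(echarDint t n) /t subrK.
have [td|dt] := ltP `|t| del.
  apply: (@le_trans _ _ e).
    rewrite distrC; apply: rP; rewrite /ball /= opprD addNKr normrN.
    exact: lt_trans dr.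
  by rewrite lerDl mulr_ge0 ?sqr_ge0 // divr_ge0 ?mulr_ge0 // ltW.
apply: (@le_trans _ _ (2 * B)).
  by rewrite (le_trans (ler_normB _ _)) // mulr2n mulrDl !mul1r lerD.
rewrite -[leLHS]add0r lerD ?(ltW e0) // mulrAC ler_pdivlMr // ler_wpM2l ?mulr_ge0 //.
rewrite sqr_normc_sub1echar lerD2l lerN2 ler_wpM2l // -[leLHS]cos_norm.
have p0 := pi_gt0 R.
rewrite normrM [`|2 * pi|]ger0_norm; last by rewrite mulr_ge0 // ltW.
by rewrite leNgt ltr_cos ?in_itv /= -?leNgt; [nra|apply/andP; split; nra|apply/andP; split; nra].
Qed.

Variable alpha : R.
Hypothesis irr : forall q : rat, alpha != ratr q.

Definition sample T (f : R -> T) (j : nat) : T := f (j%:R * alpha).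

Definition fcoef (f : R -> C) (k : int) : C :=
  cmean (sample (fun x => f x * echar (- (k%:~R * x)))).

(** Irrationality enters here: [echar (k * alpha)] differs from 1, and its powers have mean 0. *)
Lemma cmean_echar (k : int) : k != 0 -> cmean (sample (fun x => echar (k%:~R * x))) = 0.
Proof.
move=> k0; rewrite -(cmean_unit_power (z := echar (k%:~R * alpha))) ?normc_echar //.
  by apply: cmean_eq => n; rewrite /sample -echarMn mulrCA.
apply/eqP => /echar_eq1 [n nE]; have /eqP := irr (n%:~R / k%:~R); apply.
by rewrite rmorph_div /= ?unitfE ?intr_eq0 // !ratr_int -nE mulrAC mulfV ?mul1r ?intr_eq0.
Qed.

Lemma inner_echar (k l : int) : k != l ->
  inner (sample (fun x => echar (k%:~R * x))) (sample (fun x => echar (l%:~R * x))) = 0.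
Proof.
move=> kl; rewrite -(@cmean_echar (k - l)) ?subr_eq0 //; apply: cmean_eq => n.
by rewrite /sample -echarN -echarD intrB mulrBl.
Qed.

Lemma fcoefE f k : fcoef f k = inner (sample f) (sample (fun x => echar (k%:~R * x))).
Proof. by apply: cmean_eq => n; rewrite /sample echarN. Qed.

(** Riemann-Lebesgue along distinct frequencies: injectivity of [m] makes the sampled characters
    orthonormal, and Bessel's inequality applies. *)
Lemma fcoef_cvg0 (f : R -> C) (m : nat -> int) : injective m -> cbounded (sample f) ->
  (fun n => normc (fcoef f (m n))) @ \oo --> 0.
Proof.
move=> mI fb; under eq_fun do rewrite fcoefE.
apply: (bessel_cvg0 (phi := fun n => sample (fun x => echar ((m n)%:~R * x)))) => //.
  by move=> k n; exact: normc_echar.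
by move=> k l kl; apply: inner_echar; apply: contra kl => /eqP/mI ->.
Qed.

Lemma fcoef1 k : fcoef (fun=> 1) k = (k == 0)%:R.
Proof.
have [->|k0] := eqVneq k 0.
  by rewrite /fcoef -[RHS](@cmean_cst R); apply: cmean_eq => n;
    rewrite /sample mul0r oppr0 echar0 mulr1.
rewrite mulr0n -(@cmean_echar (- k)) ?oppr_eq0 //; apply: cmean_eq => n.
by rewrite /sample mul1r mulrNz mulNr.
Qed.

(** The one-sided Dirichlet kernel centred at [x0]; its squared modulus is [n] times the Fejer
    kernel. *)
Definition dirichlet (x0 : R) (n : nat) (x : R) : C := \sum_(k < n) echar (k%:R * (x - x0)).

(** The geometric sum leaves [1 - z ^+ n] with [z] on the unit circle. *)
Lemma normc_dirichlet x0 n x : normc (1 - echar (x - x0)) * normc (dirichlet x0 n x) <= 2.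
Proof.
have -> : dirichlet x0 n x = \sum_(k < n) echar (x - x0) ^+ k.
  by apply: eq_bigr => k _; exact: echarMn.
rewrite -normcM -opprB mulNr -subrX1 opprB (le_trans (le_normcD _ _)) //.
by rewrite normcN normc1 -echarMn normc_echar.
Qed.

Lemma cbounded_echar (g : nat -> R) : cbounded (fun j => echar (g j)).
Proof. by exists 1 => n; rewrite normc_echar. Qed.

(** Expanding the squared kernel into characters turns the mean into a combination of Fourier
    coefficients. *)
Lemma cmean_dirichlet f x0 n : cbounded (sample f) ->
  cmean (sample (fun x => f x * (dirichlet x0 n x * (dirichlet x0 n x)^*%C))) =
  \sum_(k < n) \sum_(l < n) echar (- ((k%:Z - l%:Z)%:~R * x0)) * fcoef f (l%:Z - k%:Z).
Proof.
move=> fb.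
pose T (k l : nat) j := echar (- ((k%:Z - l%:Z)%:~R * x0)) *
  sample (fun x => f x * echar (- ((l%:Z - k%:Z)%:~R * x))) j.
have fexb m : cbounded (sample (fun x => f x * echar (- (m * x)))).
  by apply: cboundedM => //; exact: cbounded_echar.
have Tb k l : cbounded (T k l) by exact: cboundedZ.
transitivity (cmean (fun j => \sum_(k < n) \sum_(l < n) T k l j)).
  apply: cmean_eq => j; rewrite /sample.
  have -> : (dirichlet x0 n (j%:R * alpha))^*%C =
      \sum_(l < n) echar (- (l%:R * (j%:R * alpha - x0))).
    by rewrite rmorph_sum; apply: eq_bigr => l _; rewrite echarN.
  rewrite /dirichlet big_distrlr mulr_sumr.
  apply: eq_bigr => k _; rewrite mulr_sumr; apply: eq_bigr => l _.
  rewrite -[LHS]/(f (j%:R * alpha) * (echar (k%:R * (j%:R * alpha - x0)) *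
    echar (- (l%:R * (j%:R * alpha - x0))))).
  rewrite /T /sample [RHS]mulrCA -!echarD; congr (_ * echar _).
  by rewrite !intrB; ring.
rewrite cmean_sum => [|k]; last exact: cbounded_sum.
apply: eq_bigr => k _; rewrite cmean_sum //; apply: eq_bigr => l _.
by rewrite cmeanZ.
Qed.

(** Only the [n] diagonal terms of the expansion survive. *)
Lemma mean_fejer x0 n : mean (sample (fun x => normc (dirichlet x0 n x) ^+ 2)) = n%:R.
Proof.
transitivity (complex.Re (cmean (sample (fun x =>
    1 * (dirichlet x0 n x * (dirichlet x0 n x)^*%C))))).
  by congr mean; apply/funext => j; rewrite /sample /= mul1r mulc_conj.
rewrite (cmean_dirichlet (f := fun=> 1)); last exact: cbounded_cst.
rewrite (_ : \sum_(k < n) _ = n%:R).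
  by rewrite -[n%:R in LHS](rmorph_nat (real_complex R)).
rewrite -[in RHS](card_ord n) -sumr_const; apply: eq_bigr => k _.
rewrite (bigD1 k) //= fcoef1 !subrr eqxx mulr0z mul0r oppr0 echar0 mul1r big1 ?addr0 // => l lk.
by rewrite fcoef1 subr_eq0 eqz_nat (_ : (l == k :> nat) = false) ?mulr0 //; apply/negbTE.
Qed.

(** Vanishing coefficients give mean 0 against the squared kernel. The kernel has mass [n], while
    the error made away from [x0] is bounded independently of [n]; a large [n] forces [f x0 = 0]. *)
Lemma fcoef_eq0 (f : R -> C) : (forall x, ccont f x) -> (forall x, f (x + 1) = f x) ->
  (forall k, fcoef f k = 0) -> forall x, f x = 0.
Proof.
move=> fc fp f0 x0.
have fb : cbounded (sample f).
  have [B1 H1] := continuous_periodic_bounded (fun x => (fc x).1)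
    (fun x => congr1 (@complex.Re R) (fp x)).
  have [B2 H2] := continuous_periodic_bounded (fun x => (fc x).2)
    (fun x => congr1 (@complex.Im R) (fp x)).
  by exists (B1 + B2) => n; rewrite (le_trans (normc_le_ReIm _)) //;
    apply: lerD; [exact: H1|exact: H2].
(* Multiplying by the conjugate of [f x0] reduces the claim to an upper bound for the real function
   [g], whose value at [x0] is a square. *)
pose c := (f x0)^*%C; pose g x := complex.Re (c * f x).
have gE x : ccont (fun x => c * f x) x by apply: ccontM => //; exact: ccont_cst.
have gp x : g (x + 1) = g x by rewrite /g fp.
have gx0 : g x0 = normc (f x0) ^+ 2 by rewrite /g mulrC mulc_conj.
suff : g x0 <= 0.
  rewrite gx0 => H; apply: eq0_normc; apply/eqP; rewrite -sqrf_eq0 eq_le H.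
  exact: sqr_ge0.
apply/ler_addgt0Pl => e e0; rewrite addr0.
have e20 : 0 < e / 2 by rewrite divr_gt0.
have [K K0 gK] := periodic_modulus x0 (fun x => (gE x).1) gp e20.
have Fb n : bounded_seq (sample (fun x => normc (dirichlet x0 n x) ^+ 2)).
  exists (n%:R ^+ 2) => j; rewrite ger0_norm ?sqr_ge0 // ler_sqr ?nnegrE ?normc_ge0 //.
  rewrite (le_trans (le_normc_sum _ _ _)) // -[in leRHS](card_ord n) -sumr_const.
  by apply: ler_sum => k _; rewrite normc_echar.
have key n : g x0 * n%:R <= e / 2 * n%:R + 4 * K.
  pose G := sample (fun x => c * (f x * (dirichlet x0 n x * (dirichlet x0 n x)^*%C))).
  have fDb : cbounded (sample (fun x => f x * (dirichlet x0 n x * (dirichlet x0 n x)^*%C))).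
    have Db : cbounded (sample (dirichlet x0 n)).
      by apply: cbounded_sum => k; exact: cbounded_echar.
    by apply: cboundedM => //; apply: cboundedM => //; exact: cbounded_conj.
  have Gb : cbounded G by exact: cboundedZ.
  have G0 : mean (@complex.Re R \o G) = 0.
    transitivity (complex.Re (cmean G)); first by [].
    rewrite cmeanZ // cmean_dirichlet // big1 ?mulr0 // => k _.
    by rewrite big1 // => l _; rewrite f0 mulr0.
  have cb : bounded_seq (fun _ : nat => 4 * K) by exists `|4 * K|.
  have R1 := bounded_seqZ (e / 2) (Fb n).
  (* All terms are written as means and the zero mean of [G] is added on the right, so a pointwise
     inequality suffices. *)
  rewrite -(mean_fejer x0 n) -(meanZ (g x0) (Fb n)) -(meanZ (e / 2) (Fb n)).
  rewrite -[4 * K](mean_cst (4 * K)) -(meanD R1 cb) -[leRHS]add0r -{1}G0.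
  rewrite -(meanD (cbounded_Re Gb) (bounded_seqD R1 cb)); apply: le_mean.
  - exact: bounded_seqZ.
  - by apply: bounded_seqD; [exact: cbounded_Re|exact: bounded_seqD].
  move=> j; rewrite /= /G /sample; set x := j%:R * alpha.
  have -> : complex.Re (c * (f x * (dirichlet x0 n x * (dirichlet x0 n x)^*%C))) =
      g x * normc (dirichlet x0 n x) ^+ 2.
    by rewrite mulc_conj mulrA complex_ReM /= mulr0 subr0.
  have := gK x; rewrite ler_norml => /andP[gl _].
  have D4 : normc (1 - echar (x - x0)) ^+ 2 * normc (dirichlet x0 n x) ^+ 2 <= 4.
    rewrite -exprMn (_ : 4 = 2 ^+ 2); last ring.
    by rewrite ler_sqr ?nnegrE ?mulr_ge0 ?normc_ge0 // normc_dirichlet.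
  have D0 := sqr_ge0 (normc (dirichlet x0 n x)).
  move: gl D4 D0; set F := normc (dirichlet _ _ _) ^+ 2; set h := normc _ ^+ 2.
  move=> gl D4 D0.
  have : (g x0 - g x) * F <= (e / 2 + K * h) * F by apply: ler_wpM2r => //; lra.
  have : K * (h * F) <= K * 4 by apply: ler_wpM2l.
  lra.
(* This [n] makes [4 * K] smaller than [e / 2 * n]. *)
have [n nK] : exists n : nat, 8 * K / e < n%:R.
  by exists (Num.truncn (8 * K / e)).+1; rewrite truncnS_gt.
have n0 : 0 < n%:R :> R by apply: le_lt_trans nK; rewrite divr_ge0 ?mulr_ge0 // ltW.
rewrite -(ler_pM2r n0) (le_trans (key n)) //.
by move: nK; rewrite ltr_pdivrMr //; nra.
Qed.
End Characters.

(** * From a reducible Schroedinger cocycle to decaying dual orbits *)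

(** Boundedness of the terms at [x0 + r / 2] gives geometric control of the coefficients, hence a
    Lipschitz bound at [x0]. *)
Lemma real_analytic_continuous (R : realType) (f : R -> R) x0 :
  real_analytic f -> {for x0, continuous f}.
Proof.
move=> /(_ x0) [r r0 [a fa]].
have r20 : 0 < r / 2 by rewrite divr_gt0.
have [K K0 aK] : exists2 K, 0 <= K & forall n, `|a n * (r / 2) ^+ n| <= K.
  have /fa : `|x0 + r / 2 - x0| < r by rewrite addrAC subrr add0r gtr0_norm //; lra.
  rewrite addrAC subrr add0r => /cvgP /cvg_series_cvg_0 /cvgP /cvg_seq_bounded.
  case=> M [_ HM]; exists (`|M| + 1); first by rewrite addr_ge0.
  by move=> n; apply: (HM (`|M| + 1)) => //; rewrite (le_lt_trans (ler_norm M)) // ltrDl.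
(* The radius [r / 4] makes the ratio [q] at most [1/2]. *)
have fq x : `|x - x0| <= r / 4 -> `|f x - a 0%N| <= 2 * K * (`|x - x0| / (r / 2)).
  move=> xr; set q := `|x - x0| / (r / 2).
  have q0 : 0 <= q by rewrite divr_ge0 // ltW.
  have q2 : 2 * q <= 1 by rewrite /q mulrA ler_pdivrMr //; lra.
  have xlt : `|x - x0| < r by lra.
  have geo n : \sum_(k < n) q ^+ k.+1 <= 2 * q.
    (* The added tail bound closes the induction because [2 * q <= 1]. *)
    suff : \sum_(k < n) q ^+ k.+1 + 2 * q ^+ n.+1 <= 2 * q.
      by apply: le_trans; rewrite lerDl mulr_ge0 // exprn_ge0.
    elim: n => [|n IH]; first by rewrite big_ord0 add0r expr1.
    apply: le_trans IH; rewrite big_ord_recr /= -addrA lerD2l.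
    rewrite (exprSr q n.+1); have := exprn_ge0 n.+1 q0; set Q := q ^+ n.+1 => Q0.
    nra.
  have term k : `|a k.+1 * (x - x0) ^+ k.+1| <= K * q ^+ k.+1.
    have -> : a k.+1 * (x - x0) ^+ k.+1 =
        (a k.+1 * (r / 2) ^+ k.+1) * ((x - x0) / (r / 2)) ^+ k.+1.
      rewrite -mulrA -exprMn [X in _ = _ * X ^+ _](_ : _ = x - x0) //.
      by rewrite mulrCA divff ?mulr1 // gt_eqF.
    rewrite normrM normrX [`|(x - x0) / _|]normrM normfV (gtr0_norm r20) -/q.
    by rewrite ler_wpM2r ?exprn_ge0.
  have lim := fa x xlt.
  have limn : (fun n => `|series (fun n => a n * (x - x0) ^+ n) n - a 0%N|) @ \oo
      --> `|f x - a 0%N|.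
    by apply: cvg_norm; apply: cvgB => //; exact: cvg_cst.
  rewrite -(cvg_lim (@Rhausdorff R) limn); apply: limr_le.
    by apply/cvg_ex; eexists; exact: limn.
  near=> n.
  have [m ->] : exists m, n = m.+1.
    by exists n.-1; rewrite prednK //; near: n; exists 1%N.
  rewrite /series /= big_mkord big_ord_recl expr0 mulr1 addrAC subrr add0r.
  apply: (le_trans (ler_norm_sum _ _ _)).
  apply: (@le_trans _ _ (\sum_(k < m) K * q ^+ k.+1)).
    by apply: ler_sum => k _; exact: term.
  by rewrite -mulr_sumr [2 * K]mulrC -mulrA ler_wpM2l.
have a0 : f x0 = a 0%N.
  have := fq x0; rewrite subrr normr0 mul0r mulr0 => /(_ (ltW _)).
  rewrite normr_le0 subr_eq0 => H; apply/eqP; apply: H; lra.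
apply/cvgrPdist_le => e e0.
pose del := Num.min (r / 4) (e * (r / 2) / (2 * K + 1)).
have d0 : 0 < del by rewrite lt_min !divr_gt0 ?mulr_gt0 //; lra.
near=> x.
have xd : `|x - x0| <= del.
  by rewrite distrC; near: x; apply/nbhs_ballP; exists del => //= y /ltW.
have [xr xe] : `|x - x0| <= r / 4 /\ `|x - x0| <= e * (r / 2) / (2 * K + 1).
  by move: xd; rewrite le_min => /andP.
rewrite distrC a0 (le_trans (fq x xr)) // mulrA ler_pdivrMr //.
move: xe; rewrite ler_pdivlMr; last lra.
have := normr_ge0 (x - x0); nra.
Unshelve. all: by end_near. Qed.

Lemma cvg0_sum (R : realType) I (r : seq I) (g : I -> nat -> R) :
  (forall i, g i @ \oo --> 0) -> (fun n => \sum_(i <- r) g i n) @ \oo --> 0.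
Proof.
move=> g0; elim: r => [|i r IH].
  by under eq_fun do rewrite big_nil; exact: cvg_cst.
rewrite (_ : (fun n => _) = g i \+ (fun n => \sum_(j <- r) g j n)).
  have gD := cvgD (g0 i) IH; rewrite (addr0 (0 : R)) in gD.
  exact: gD.
by apply/funext => n; rewrite big_cons.
Qed.

Section FourierDual.
Variable R : realType.
Local Notation C := R[i].
Variable alpha : R.
Hypothesis irr : forall q : rat, alpha != ratr q.
Variables (d : nat) (v : int -> C).
Local Notation fcoef := (fcoef alpha).

Definition cbounded_fun (f : R -> C) := exists K, forall x, normc (f x) <= K.

Lemma cbounded_fcoef f k : cbounded_fun f ->
  cbounded (sample alpha (fun x => f x * echar (- (k%:~R * x)))).
Proof.
move=> [K fK]; apply: cboundedM; last exact: cbounded_echar.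
by exists K => n; exact: fK.
Qed.

Lemma cbounded_funD f g : cbounded_fun f -> cbounded_fun g -> cbounded_fun (f \+ g).
Proof.
by move=> [K fK] [L gL]; exists (K + L) => x; rewrite (le_trans (le_normcD _ _)) ?lerD.
Qed.

Lemma cbounded_funZ c f : cbounded_fun f -> cbounded_fun (fun x => c * f x).
Proof. by move=> [K fK]; exists (normc c * K) => x; rewrite normcM ler_wpM2l ?normc_ge0. Qed.

Lemma cbounded_fun_trans f t : cbounded_fun f -> cbounded_fun (fun x => f (x + t)).
Proof. by move=> [K fK]; exists K => x; exact: fK. Qed.

Lemma fcoefD f g k : cbounded_fun f -> cbounded_fun g ->
  fcoef (f \+ g) k = fcoef f k + fcoef g k.
Proof.
move=> fb gb; rewrite /fcoef -cmeanD; [|exact: cbounded_fcoef|exact: cbounded_fcoef].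
by apply: cmean_eq => n; rewrite /sample /= mulrDl.
Qed.

Lemma fcoefZ c f k : cbounded_fun f -> fcoef (fun x => c * f x) k = c * fcoef f k.
Proof.
move=> fb; rewrite /fcoef -cmeanZ; last exact: cbounded_fcoef.
by apply: cmean_eq => n; rewrite /sample /= mulrA.
Qed.

(** Translation by [alpha] shifts the samples by one index, which the mean does not see. *)
Lemma fcoef_trans f k : cbounded_fun f ->
  fcoef (fun x => f (x + alpha)) k = echar (k%:~R * alpha) * fcoef f k.
Proof.
move=> fb; rewrite /fcoef -cmeanZ; last exact: cbounded_fcoef.
rewrite -[RHS]cmean_shift; last by apply: cboundedZ; exact: cbounded_fcoef.
apply: cmean_eq => n; rewrite /sample [RHS]mulrCA -echarD -natr1.
by congr (f _ * echar _); ring.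
Qed.

Lemma trig_polyCE x : trig_polyC d v x =
  \sum_(j < d.*2.+1) v (j%:Z - d%:Z) * echar ((j%:Z - d%:Z)%:~R * x).
Proof. by apply: eq_bigr => j _; rewrite /echar !mulrA. Qed.

(** Multiplication by a trigonometric polynomial becomes convolution with its coefficients. *)
Lemma fcoef_trig f k : cbounded_fun f ->
  fcoef (fun x => trig_polyC d v x * f x) k =
  \sum_(j < d.*2.+1) v (j%:Z - d%:Z) * fcoef f (k - (j%:Z - d%:Z)).
Proof.
move=> fb; rewrite /fcoef.
under [RHS]eq_bigr do rewrite -(cmeanZ _ (cbounded_fcoef _ fb)).
rewrite -cmean_sum; last by move=> j; apply: cboundedZ; exact: cbounded_fcoef.
apply: cmean_eq => n; rewrite /sample trig_polyCE mulr_suml mulr_suml.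
apply: eq_bigr => j _; set x := _ * alpha.
have -> : - ((k - (j%:Z - d%:Z))%:~R * x) = (j%:Z - d%:Z)%:~R * x + - (k%:~R * x).
  by rewrite !intrB; ring.
by rewrite echarD; ring.
Qed.

Hypothesis vreal : forall x : R, complex.Im (trig_polyC d v x) = 0.

Lemma fcoef_trig_poly k : (`|k| <= d)%N -> fcoef (trig_polyC d v) k = v k.
Proof.
move=> kd.
have -> : fcoef (trig_polyC d v) k = fcoef (fun x => trig_polyC d v x * 1) k.
  by apply: cmean_eq => n; rewrite /sample mulr1.
rewrite fcoef_trig; last by exists 1 => x; rewrite normc1.
have kd1 : (absz (k + d%:Z)%R < d.*2.+1)%N by lia.
rewrite (bigD1 (Ordinal kd1)) //= fcoef1 // big1 ?addr0.
  by rewrite (_ : (absz (k + d%:Z))%:Z - d%:Z = k) ?subrr ?eqxx ?mulr1 //; lia.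
move=> j /eqP jk; rewrite fcoef1 // (_ : _ == 0 = false) ?mulr0 //.
by apply/negP => /eqP h; apply: jk; apply: val_inj => /=; lia.
Qed.

(** The [v k] are the Fourier coefficients of the polynomial, and those of a real-valued function
    are conjugate under change of sign of [k]. *)
Lemma trig_coef_conj k : (`|k| <= d)%N -> v (- k) = (v k)^*%C.
Proof.
move=> kd; rewrite -(fcoef_trig_poly kd) -(@fcoef_trig_poly (- k)) ?abszN //.
rewrite /fcoef -cmean_conj.
  apply: cmean_eq => n; rewrite /sample; set x := _ * alpha.
  have tE : trig_polyC d v x = (trig_polyC d v x)^*%C.
    by have := vreal x; case: (trig_polyC d v x) => p q /= ->; rewrite oppr0.
  by rewrite echarN mulrNz mulNr {1}tE -rmorphM.
apply: cbounded_fcoef; exists (\sum_(j < d.*2.+1) normc (v (j%:Z - d%:Z))) => x.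
rewrite trig_polyCE (le_trans (le_normc_sum _ _ _)) //.
by apply: ler_sum => j _; rewrite normcM normc_echar mulr1.
Qed.

(** With [u k := fcoef f (- k)], the entries are [u (n + d - 1)] down to [u (n - d)]. The reflection
    turns the convolution into the sum of [v k * u (n + k)] in the dual operator. *)
Definition dual_state (f : R -> C) (n : int) : 'cV[C]_(d.*2) :=
  \col_i fcoef f (- (n + d%:Z - 1 - i%:Z)).

Lemma dual_stateD f g n : cbounded_fun f -> cbounded_fun g ->
  dual_state (f \+ g) n = dual_state f n + dual_state g n.
Proof. by move=> fb gb; apply/colP => i; rewrite !mxE fcoefD. Qed.

Lemma dual_stateZ c f n : cbounded_fun f ->
  dual_state (fun x => c * f x) n = c *: dual_state f n.
Proof. by move=> fb; apply/colP => i; rewrite !mxE fcoefZ. Qed.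

Lemma dual_state_cvg0 f (s : nat -> int) : cbounded_fun f -> injective s ->
  (fun n => hnorm (dual_state f (s n))) @ \oo --> 0.
Proof.
move=> fb sI.
apply: (@squeeze_cvgr _ _ _ _ (fun=> 0)
  (fun n => \sum_(i < d.*2) normc (fcoef f (- (s n + d%:Z - 1 - i%:Z))))).
- apply: nearW => n; rewrite hnorm_ge0 (le_trans (hnorm_le_mxnorm1 _)) //.
  by apply: ler_sum => i _; rewrite big_ord1 mxE.
- exact: cvg_cst.
- apply: cvg0_sum => i; apply: (fcoef_cvg0 irr (m := fun n => - (s n + d%:Z - 1 - i%:Z))).
    by move=> p q pq; apply: sI; move: pq; lia.
  by case: fb => K fK; exists K => n; exact: fK.
Qed.

Hypotheses (d1 : (1 <= d)%N) (vd : v d%:Z != 0).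

(** Aubry duality: on Fourier coefficients the two translations become the cosine potential and the
    potential becomes the finite-range hopping. *)
Lemma dual_state_orbit E f : cbounded_fun f ->
  (forall x, f (x + alpha) + f (x - alpha) + trig_polyC d v x * f x = E%:C%C * f x) ->
  dual_orbit v E alpha (dual_state f).
Proof.
move=> fb fE n.
have rec k : echar (k%:~R * alpha) * fcoef f k + echar (- (k%:~R * alpha)) * fcoef f k +
    \sum_(j < d.*2.+1) v (j%:Z - d%:Z) * fcoef f (k - (j%:Z - d%:Z)) = E%:C%C * fcoef f k.
  have fmb : cbounded_fun (fun x => f (x - alpha)) by exact: cbounded_fun_trans.
  have fpb : cbounded_fun (fun x => f (x + alpha)) by exact: cbounded_fun_trans.
  have <- : fcoef (fun x => f (x - alpha)) k = echar (- (k%:~R * alpha)) * fcoef f k.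
    (* The rule for translation by [+ alpha] is applied to the function translated by [- alpha]. *)
    have -> : fcoef f k = echar (k%:~R * alpha) * fcoef (fun x => f (x - alpha)) k.
      by rewrite -fcoef_trans //; apply: cmean_eq => m; rewrite /sample addrK.
    by rewrite mulrA -echarD addNr echar0 mul1r.
  (* Boundedness of this product is read off from the equation for [f]. *)
  have tb : cbounded_fun (fun x => trig_polyC d v x * f x).
    have -> : (fun x => trig_polyC d v x * f x) =
        (fun x => E%:C%C * f x) \+ (fun x => -1 * (f (x + alpha) + f (x - alpha))).
      by apply/funext => x; rewrite /= -fE; ring.
    by apply: cbounded_funD; apply: cbounded_funZ => //; exact: cbounded_funD.
  rewrite -fcoef_trans // -fcoef_trig // -fcoefZ // -!fcoefD //; last exact: cbounded_funD.
  by apply: cmean_eq => m; rewrite /sample /= fE.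
pose u (k : int) := fcoef f (- k).
have h0 : (0 < d.*2)%N by lia.
have recu : \sum_(p < d.*2.+1) v (d%:Z - p%:Z) * u (n + d%:Z - p%:Z) =
    (E - 2 * cos (2 * pi * (n%:~R * alpha)))%:C%C * u n.
  have echarE : echar ((- n)%:~R * alpha) + echar (- ((- n)%:~R * alpha)) =
      (2 * cos (2 * pi * (n%:~R * alpha)))%:C%C.
    by rewrite mulrNz mulNr opprK echarN /echar; simpc; congr (_ +i* _)%C; ring.
  have -> : (E - 2 * cos (2 * pi * (n%:~R * alpha)))%:C%C =
      E%:C%C - (echar ((- n)%:~R * alpha) + echar (- ((- n)%:~R * alpha))).
    by rewrite echarE -rmorphB.
  rewrite mulrBl /u -rec.
  have -> : \sum_(p < d.*2.+1) v (d%:Z - p%:Z) * fcoef f (- (n + d%:Z - p%:Z)) =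
      \sum_(j < d.*2.+1) v (j%:Z - d%:Z) * fcoef f (- n - (j%:Z - d%:Z)).
    rewrite (reindex_inj rev_ord_inj) /=; apply: eq_bigr => j _.
    have jd := ltn_ord j; congr (_ * _); [congr v; lia|congr fcoef; lia].
  ring.
(* The leading entry is first left as the matrix produces it. *)
pose z p := if p is p'.+1 then u (n + d%:Z - p%:Z)
  else (dual_mat d v E (n%:~R * alpha) *m dual_state f n) (Ordinal h0) 0.
have zS (j : 'I_(d.*2)) : z j.+1 = dual_state f n j 0.
  by rewrite mxE /z /u; congr fcoef; lia.
have zA (j : 'I_(d.*2)) : z j = (dual_mat d v E (n%:~R * alpha) *m dual_state f n) j 0.
  case: j => -[|j] hj; first by rewrite /z /=; congr (_ _ _); apply: val_inj.
  have hj' : (j < d.*2)%N by lia.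
  by rewrite (@dual_mat_mulS _ _ _ _ _ _ _ (Ordinal hj')) // -zS.
(* [z] and the Fourier coefficients satisfy the same equation and agree off the leading site, whose
   coefficient [v d] is nonzero. *)
have z0 : z 0%N = u (n + d%:Z).
  have := dual_mat_recE d1 vd zS zA.
  have zE p : (0 < p)%N -> z p = u (n + d%:Z - p%:Z) by case: p.
  have -> : z d = u n by rewrite zE // addrK.
  rewrite -recu !big_ord_recl /= !subr0 => /eqP.
  by rewrite -subr_eq0 opprD addrACA subrr addr0 -mulrBr mulf_eq0 (negPf vd) subr_eq0 => /eqP.
apply/colP => i; rewrite -zA mxE; case: i => -[|i] hi /=.
  by rewrite -/(z 0%N) z0 /u; congr fcoef; lia.
by rewrite /u; congr fcoef; lia.
Qed.
End FourierDual.

(** * The first row of the conjugation and the conclusion *)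

Lemma det_mx22 (R : comNzRingType) (M : 'M[R]_2) :
  \det M = M 0 0 * M 1 1 - M 0 1 * M 1 0.
Proof.
have l01 : lift 0 0 = 1 :> 'I_2 by apply: val_inj.
have l10 : lift 1 0 = 0 :> 'I_2 by apply: val_inj.
rewrite (expand_det_row _ 0) !big_ord_recl big_ord0 l01 /cofactor !det_mx11 !mxE l01 l10 /=.
by rewrite expr0 expr1; ring.
Qed.

(** The conjugacy reads [S(x) B(x) = B(x + alpha)]: its second row expresses the lower entries by
    the upper ones, and its first row is then the Schroedinger equation. *)
Lemma cocycle_rows (R : realType) (alpha E : R) d (vhat : int -> R[i]) (B : R -> 'M[R]_2) :
  (forall x, \det (B x) = 1) ->
  (forall x, invmx (B (x + alpha)) *m schr d vhat E x *m B x = 1%:M) ->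
  forall x j, B (x + alpha) 0 j + B (x - alpha) 0 j + trig_poly d vhat x * B x 0 j =
    E * B x 0 j /\ B x 1 j = B (x - alpha) 0 j.
Proof.
move=> detB conj.
have SB x : schr d vhat E x *m B x = B (x + alpha).
  rewrite -[LHS]mul1mx -(@mulmxV _ _ (B (x + alpha))); last by rewrite unitmxE detB unitr1.
  by rewrite -!mulmxA [X in _ *m X]mulmxA conj mulmx1.
have row1 x j : B x 1 j = B (x - alpha) 0 j.
  by rewrite -{1}[x](subrK alpha) -SB mxE !big_ord_recl big_ord0 !mxE /=; ring.
move=> x j; split => //; rewrite -SB -row1 mxE !big_ord_recl big_ord0 !mxE /=.
have -> : lift 0 0 = 1 :> 'I_2 by apply: val_inj.
ring.
Qed.

Theorem theorem1p5 (R : realType) (alpha : R) (d : nat) (vhat : int -> R[i]) (E : R) :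
  (forall q : rat, alpha != ratr q) ->
  (1 <= d)%N ->
  vhat (d%:Z) != 0 ->
  (forall x : R, complex.Im (trig_polyC d vhat x) = 0) ->
  PH2 d alpha (dual_mat d vhat E) ->
  ~ exists B : R -> 'M[R]_2,
      analytic_SL2_loop B /\
      (forall x : R, invmx (B (x + alpha)) *m schr d vhat E x *m B x = 1%:M).
Proof.
move=> irr d1 vd vreal [_ [_ [Ep [Em [N]]]]].
move=> [per [cp [cm [decomp [trivI [invp [invm [N1 dom]]]]]]]] [B [[B1 [detB anB]] conjB]].
have vN := trig_coef_conj irr vreal.
have rows := cocycle_rows detB conjB.
pose a j x : R[i] := (B x 0 j)%:C%C.
have cont j x : {for x, continuous (fun x => B x 0 j)} by exact: real_analytic_continuous.
have ab j : cbounded_fun (a j).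
  have [K HK] := continuous_periodic_bounded (cont j)
    (fun x => congr1 (fun M : 'M[R]_2 => M 0 j) (B1 x)).
  by exists K => x; rewrite normc_real.
have aE j x : a j (x + alpha) + a j (x - alpha) + trig_polyC d vhat x * a j x = E%:C%C * a j x.
  have [H _] := rows x j.
  have -> : trig_polyC d vhat x = (trig_poly d vhat x)%:C%C.
    by have := vreal x; rewrite /trig_poly; case: (trig_polyC _ _ _) => p q /= ->.
  by rewrite /a -!rmorphM -!rmorphD H.
have orb j := dual_state_orbit d1 vd (ab j) (aE j).
have pos j : (fun n : nat => hnorm (dual_state alpha d (a j) n)) @ \oo --> 0.
  by apply: (dual_state_cvg0 irr d (s := fun n : nat => n%:Z)) => // p q [].
have neg j : (fun n : nat => hnorm (dual_state alpha d (a j) (- n%:Z))) @ \oo --> 0.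
  by apply: (dual_state_cvg0 irr d (s := fun n : nat => - n%:Z)) => // p q /oppr_inj [].
have [[c1 c2] /= c0 cE] := decaying_orbits_dependent vN d1 vd per cp cm decomp trivI invp invm
  N1 dom (orb 0) (orb 1) (pos 0) (neg 0) (pos 1) (neg 1).
(* [f] solves the same equation and its dual orbit vanishes at time 0, hence at all times; all its
   Fourier coefficients are 0 and so is [f]. *)
pose f := (fun x => c1 * a 0 x) \+ (fun x => c2 * a 1 x).
have fb : cbounded_fun f by apply: cbounded_funD; exact: cbounded_funZ.
have f_eq x : f (x + alpha) + f (x - alpha) + trig_polyC d vhat x * f x = E%:C%C * f x.
  have H0 := aE 0 x; have H1 := aE 1 x.
  rewrite /f /= [RHS]mulrDr mulrCA -H0 [E%:C%C * _]mulrCA -H1; ring.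
have st0 : dual_state alpha d f 0 = 0.
  rewrite dual_stateD; [|exact: cbounded_funZ|exact: cbounded_funZ].
  by rewrite !dual_stateZ.
have stn := dual_orbit_eq0 vN d1 vd (dual_state_orbit d1 vd fb f_eq) st0.
have h0 : (0 < d.*2)%N by rewrite double_gt0.
have fc0 k : fcoef alpha f k = 0.
  (* At time [- k - d + 1] the first entry of the state is the coefficient of index [k]. *)
  have /colP/(_ (Ordinal h0)) := stn (- k - d%:Z + 1); rewrite !mxE => <-.
  by congr fcoef => /=; lia.
have f0 : forall x, f x = 0.
  apply: (fcoef_eq0 irr) => // x.
    have ca j : ccont (a j) x by split; [exact: cont|exact: cvg_cst].
    by apply: ccontD; apply: ccontM => //; exact: ccont_cst.
  by rewrite /f /a /= B1.
(* The second row of [B 0] is the first row at [- alpha], so the determinant becomes a Wronskian of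
   the two solutions. *)
have det0 : a 0 0 * a 1 (- alpha) - a 1 0 * a 0 (- alpha) = 1.
  have [_ R0] := rows 0 0; have [_ R1] := rows 0 1; rewrite sub0r in R0 R1.
  have := detB 0; rewrite det_mx22 R0 R1 => H.
  by rewrite /a -!rmorphM -rmorphB H.
have := f0 0; have := f0 (- alpha); rewrite /f /= => e2 e1.
(* Cramer's rule for the equations [f 0 = 0] and [f (- alpha) = 0]. *)
move/eqP: c0; apply; congr (_, _).
- rewrite -[c1]mulr1 -det0.
  transitivity ((c1 * a 0 0 + c2 * a 1 0) * a 1 (- alpha) -
    (c1 * a 0 (- alpha) + c2 * a 1 (- alpha)) * a 1 0); first ring.
  by rewrite e1 e2 !mul0r subrr.
- rewrite -[c2]mulr1 -det0.
  transitivity ((c1 * a 0 (- alpha) + c2 * a 1 (- alpha)) * a 0 0 -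
    (c1 * a 0 0 + c2 * a 1 0) * a 0 (- alpha)); first ring.
  by rewrite e1 e2 !mul0r subrr.
Qed.
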